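(* Let $p\ge1$. The space $\bigl(\mathscr H^p(V),\boxplus,\odot,\mathbb R\bigr)$, i.e. the set $\mathscr H^p(V)$ with addition $\boxplus$ and scalar multiplication $\odot:\mathbb R\times\mathscr H^p(V)\to\mathscr H^p(V)$, is a vector space over $\mathbb R$.
   Context: Setting. $J=[S,T]$ is a fixed compact interval and $\triangle_J=\{(s,t)\in J^2: s\le t\}$. $V$ is a Banach space; $V^{\otimes n}$ ($V^{\otimes 0}=\mathbb R$) denotes its completed tensor powers with admissible norms: permutations in $S_n$ act by isometries on $V^{\otimes n}$, and $\|v\otimes w\|\le\|v\|\|w\|$. $T^{(k)}(V)=\bigoplus_{i=0}^kV^{\otimes i}$ with product $(a\otimes b)^i=\sum_{j=0}^i a^j\otimes b^{i-j}$; $a^i$ is the level-$i$ component. A control on $J$ is a continuous $\omega:\triangle_J\to[0,\infty)$ with $\omega(t,t)=0$ and $\omega(s,u)+\omega(u,t)\le\omega(s,t)$ for $s\le u\le t$. Put $x!:=\Gamma(x+1)$, $\beta(p)=p\bigl(1+\sum_{r=3}^\infty(\frac{2}{r-2})^{(\lfloor p\rfloor+1)/p}\bigr)$. A map $X:\triangle_J\to T^{(k)}(V)$ has finite $p$-variation controlled by $\omega$ with constant $K$ if $\|X^i_{s,t}\|\le K\,\omega(s,t)^{i/p}/(\beta(p)(i/p)!)$ for $i=1,\dots,k$, $(s,t)\in\triangle_J$. A multiplicative functional of degree $k$ is a continuous $X:\triangle_J\to T^{(k)}(V)$ with $X^0\equiv1$ and $X_{s,u}\otimes X_{u,t}=X_{s,t}$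 for $s\le u\le t$. $\Omega^{(k,p)}(V)$: those of finite $p$-variation for some control and constant; $\Omega^p(V):=\Omega^{(\lfloor p\rfloor,p)}(V)$ ($p$-rough paths). Sewing. For $\theta>1$, $\Omega^{\mathrm{am},(k,p)}_{\theta,\omega}(V)$ is the set of maps $X=(1,X^1,\dots,X^k):\triangle_J\to T^{(k)}(V)$ that for some $K\ge0$ have finite $p$-variation controlled by $\omega$ with constant $K$ and satisfy $\|(X_{s,u}\otimes X_{u,t}-X_{s,t})^i\|\le K\omega(s,t)^\theta$ for $s\le u\le t$, $i=1,\dots,k$. By Lyons' rough sewing lemma, for such $X$ there is a unique multiplicative functional $\bar X$ of degree $k$ with finite $p$-variation such that $\|\bar X^i_{s,t}-X^i_{s,t}\|\le C\omega(s,t)^\theta$ for some $C$ and all $(s,t)$, $i=1,\dots,k$; it is independent of the witnessing $(p,\theta,\omega)$ and denoted $\mathscr S^k(X)$. $\mathscr H^p(V)$ is the set of $H\in\Omega^p(V)$ for which there are a control $\omega$, $\phi\in(1-\frac1p,1]$ and $K\ge0$ with $\|H^j_{s,t}\|\le K\omega(s,t)^\phi$ for $j=1,\dots,\lfloor p\rfloor$, $(s,t)\in\triangle_J$. Addition. For $X\in\Omega^p(V)$, $H\in\mathscr H^p(V)$ let $(X\oplus H)_{s,t}:=(1,X^1_{s,t}+H^1_{s,t},\dots,X^{\lfloor p\rfloor}_{s,t}+H^{\lfloor p\rfloor}_{s,t})$; this lies in some $\Omega^{\mathrm{am},(\lfloor p\rfloor,p)}_{\theta,\omega}(V)$, and $X\boxplus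 H:=\mathscr S^{\lfloor p\rfloor}(X\oplus H)\in\Omega^p(V)$. Here $\boxplus$ is used for $X,H\in\mathscr H^p(V)$. Extension, development and lift. If $Z$ is a multiplicative functional of degree $j$ with finite $q$-variation for some $q\in[1,j+1)$, $\operatorname{Ext}_j(Z)$ is the unique multiplicative functional of degree $j+1$ agreeing with $Z$ in levels $\le j$ and of finite $q$-variation (Lyons' extension theorem; independent of such $q$). For $H\in\mathscr H^p(V)$ with exponent $\phi$ and $1\le j\le\lfloor p\rfloor-1$, $(1,H^1,\dots,H^j)$ has finite $(j/\phi)$-variation with $j/\phi<j+1$. Define $\operatorname{dev}(H):=(0,H^1,H^2-E^2,\dots,H^{\lfloor p\rfloor}-E^{\lfloor p\rfloor})$ with $E^{j+1}:=(\operatorname{Ext}_j(1,H^1,\dots,H^j))^{j+1}$. It belongs to $\mathfrak I^p(V)$, the set of additive maps $I=(0,I^1,\dots,I^{\lfloor p\rfloor}):\triangle_J\to T^{(\lfloor p\rfloor)}(V)$ ($I_{s,u}+I_{u,t}=I_{s,t}$) for which there are a control $\omega$, $\phi\in(1-\frac1p,1]$ and $K\ge0$ with $\|I^j_{s,t}\|\le K\omega(s,t)^\phi$ for $j=1,\dots,\lfloor p\rfloor$ and $\|I^{\lfloor p\rfloor}_{s,t}\|\le K\omega(s,t)^{\lfloor p\rfloor/p}$. For $I\in\mathfrak I^p(V)$ define recursively $\mathbb 1^{(0,I^1)}:=(1,I^1)$, $\mathbb 1^{(0,I^1,\dots,I^m)}:=\operatorname{Ext}_{m-1}(\mathbb 1^{(0,I^1,\dots,I^{m-1})})+(0,\dots,0,I^m)$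 for $2\le m\le\lfloor p\rfloor$; $\mathbb 1^I\in\mathscr H^p(V)$ is the result for $m=\lfloor p\rfloor$. Scalar multiplication. For $a\in\mathbb R$, $H\in\mathscr H^p(V)$: $a\odot H:=\mathbb 1^{a\operatorname{dev}(H)}$, where $a\operatorname{dev}(H)$ is the pointwise scalar multiple. *)

(* Defs.v *)
From HB Require Import structures.
From mathcomp Require Import all_boot all_order all_algebra all_fingroup.
From mathcomp Require Import all_classical all_reals all_analysis.

Set Implicit Arguments.
Unset Strict Implicit.
Unset Printing Implicit Defensive.

Import Order.TTheory GRing.Theory Num.Theory numFieldNormedType.Exports.

Local Open Scope classical_set_scope.
Local Open Scope ring_scope.

(* The set A, equipped with add and scale, is a vector space: its subtype
   carries an lmodType structure whose two operations are add and scale.  In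
   particular A is closed under both. *)
Definition is_vector_space (R : realType) (X : Type) (A : set X)
    (add : X -> X -> X) (scale : R -> X -> X) : Prop :=
  exists c : GRing.Lmodule.axioms_ R (set_type A),
    let L : lmodType R := GRing.Lmodule.Pack c in
    (forall x y : L,
       set_val (x + y : set_type A)
       = add (set_val (x : set_type A)) (set_val (y : set_type A))) /\
    (forall (a : R) (x : L),
       set_val (a *: x : set_type A) = scale a (set_val (x : set_type A))).

Definition Gamma (R : realType) (x : R) : R :=
  \int[lebesgue_measure]_(t in `]0, +oo[) (t `^ (x - 1) * expR (- t)).

Definition rfact (R : realType) (x : R) : R := Gamma (x + 1).

Definition beta (R : realType) (p : R) : R :=
  p * (1 + limn (fun n : nat =>
    \sum_(3 <= r < n) (2 / (r - 2)%N%:R) `^ (((Num.truncn p).+1)%:R / p))).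

Definition multilinear (R : realType) (U W : lmodType R) (n : nat)
    (f : ('I_n -> U) -> W) : Prop :=
  forall (v : 'I_n -> U) (i : 'I_n) (a : R) (x y : U),
    f (dfwith v i (a *: x + y)) = a *: f (dfwith v i x) + f (dfwith v i y).

Definition fam_cat (U : Type) (m n : nat) (v : 'I_m -> U) (w : 'I_n -> U) :
    'I_(m + n) -> U :=
  fun i => match fintype.split i with inl j => v j | inr j => w j end.

(* The completed tensor powers of V for a family of admissible norms.  The
   linear span of the elementary tensors pure v in tpow n is the algebraic
   tensor power (pure_universal) and is dense in the Banach space tpow n
   (pure_dense); norm_pure0 and norm_pure1 express that the powers 0 and 1 are
   R and V themselves. *)
Record tensor_powers (R : realType) (V : completeNormedModType R) := {
  tpow :> nat -> completeNormedModType R;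
  pure : forall n, ('I_n -> V) -> tpow n;
  tens : forall m n, tpow m -> tpow n -> tpow (m + n);
  pure_multilinear : forall n, multilinear (@pure n);
  pure_universal : forall n (W : lmodType R) (f : ('I_n -> V) -> W),
    multilinear f ->
    exists g : {linear tpow n -> W}, forall v, g (pure v) = f v;
  pure_dense : forall n, dense
    [set x : tpow n | exists (m : nat) (c : 'I_m -> R) (v : 'I_m -> 'I_n -> V),
       x = \sum_i c i *: pure (v i)];
  tens_linearl : forall m n (b : tpow n),
    linear (fun a : tpow m => tens a b);
  tens_linearr : forall m n (a : tpow m),
    linear (fun b : tpow n => tens a b);
  tens_pure : forall m n (v : 'I_m -> V) (w : 'I_n -> V),
    tens (pure v) (pure w) = pure (fam_cat v w);
  norm_pure0 : forall v : 'I_0 -> V, `|pure v| = 1;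
  norm_pure1 : forall v : V, `|pure (fun _ : 'I_1 => v)| = `|v|;
  norm_tens : forall m n (a : tpow m) (b : tpow n),
    `|tens a b| <= `|a| * `|b|;
  perm_isometry : forall n (s : 'S_n),
    exists g : {linear tpow n -> tpow n},
      (forall v, g (pure v) = pure (fun i => v (s i))) /\
      (forall x, `|g x| = `|x|)
}.

Section RoughPaths.
Context (R : realType) (V : completeNormedModType R) (E : tensor_powers V).

(* T^(k)(V) is encoded as the set of sequences (a^i)_i with a^i in the i-th
   tensor power and a^i = 0 for i > k. *)
Definition tseq : Type := prod_topology (fun i : nat => E i).

Definition tensor_alg (k : nat) : set tseq :=
  [set a | forall i, (k < i)%N -> a i = 0].

Definition tone0 : E 0 := pure E (fun i : 'I_0 => 0).

Definition tone : tseq :=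
  fun i => match i return E i with 0 => tone0 | _.+1 => 0 end.

Definition tmul (k : nat) (a b : tseq) : tseq := fun i =>
  if (i <= k)%N then
    \sum_(j < i.+1)
      ecast n (E n) (subnKC (leq_ord j)) (tens (a j) (b (i - j)%N))
  else 0.

Context (S T : R).

(* Maps are defined on the subtype of pairs (s, t) with S <= s <= t <= T, so
   that equality of maps is equality of their values on that set only. *)
Definition triangle : set (R * R) :=
  [set st | [/\ S <= st.1, st.1 <= st.2 & st.2 <= T]].

Definition tmap : Type := triangle -> tseq.

(* splits a b c: a = (s, u), b = (u, t) and c = (s, t) for some s <= u <= t. *)
Definition splits (a b c : triangle) : Prop :=
  [/\ (set_val a).1 = (set_val c).1, (set_val a).2 = (set_val b).1
    & (set_val b).2 = (set_val c).2].

Definition is_control (w : triangle -> R) : Prop :=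
  [/\ continuous w,
      forall a, 0 <= w a,
      forall a, (set_val a).1 = (set_val a).2 -> w a = 0
    & forall a b c, splits a b c -> w a + w b <= w c].

Definition finite_variation (k : nat) (p : R) (w : triangle -> R) (K : R)
    (X : tmap) : Prop :=
  forall (i : nat) (a : triangle), (1 <= i <= k)%N ->
    `|X a i| <= K * w a `^ (i%:R / p) / (beta p * rfact (i%:R / p)).

Definition multiplicative (k : nat) (X : tmap) : Prop :=
  [/\ forall a, tensor_alg k (X a),
      continuous X,
      forall a, X a 0%N = tone0
    & forall a b c, splits a b c -> tmul k (X a) (X b) = X c].

Definition Omega (k : nat) (p : R) : set tmap :=
  [set X | multiplicative k X /\
     exists (w : triangle -> R) (K : R),
       is_control w /\ finite_variation k p w K X].

Definition rough_path (p : R) : set tmap := Omega (Num.truncn p) p.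

Definition almost_mult (k : nat) (p theta : R) (w : triangle -> R) :
    set tmap :=
  [set X | [/\ forall a, tensor_alg k (X a),
               forall a, X a 0%N = tone0
             & exists K : R,
                 [/\ 0 <= K,
                     finite_variation k p w K X
                   & forall a b c (i : nat), splits a b c -> (1 <= i <= k)%N ->
                       `|tmul k (X a) (X b) i - X c i| <= K * w c `^ theta]]].

Definition is_sewing (k : nat) (X Y : tmap) : Prop :=
  exists (p theta : R) (w : triangle -> R),
    [/\ 1 <= p, 1 < theta, is_control w, almost_mult k p theta w X
      & Omega k p Y /\
        exists C : R, forall a (i : nat), (1 <= i <= k)%N ->
          `|Y a i - X a i| <= C * w a `^ theta].

(* The default value of xget is irrelevant: Lyons' sewing lemma says that
   is_sewing k X has exactly one solution for X almost multiplicative. *)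
Definition sewing (k : nat) (X : tmap) : tmap :=
  xget (fun=> tone : tseq) (is_sewing k X).

Definition calH (p : R) : set tmap :=
  [set H | rough_path p H /\
     exists (w : triangle -> R) (phi K : R),
       [/\ is_control w, 1 - 1 / p < phi, phi <= 1, 0 <= K
         & forall a (j : nat), (1 <= j <= Num.truncn p)%N ->
             `|H a j| <= K * w a `^ phi]].

Definition oplus (k : nat) (X H : tmap) : tmap := fun a i =>
  match i return E i with
  | 0 => tone0
  | j.+1 => if (j < k)%N then X a j.+1 + H a j.+1 else 0
  end.

Definition boxplus (p : R) (X H : tmap) : tmap :=
  sewing (Num.truncn p) (oplus (Num.truncn p) X H).

Definition is_extension (j : nat) (Z Y : tmap) : Prop :=
  exists q : R,
    [/\ 1 <= q, q < j.+1%:R, Omega j q Z, Omega j.+1 q Y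
      & forall a (i : nat), (i <= j)%N -> Y a i = Z a i].

(* By Lyons' extension theorem is_extension j Z has exactly one solution
   whenever Z is in Omega j q for some q in [1, j + 1). *)
Definition Ext (j : nat) (Z : tmap) : tmap :=
  xget (fun=> tone : tseq) (is_extension j Z).

Definition truncate (j : nat) (X : tmap) : tmap := fun a i =>
  if (i <= j)%N then X a i else 0.

Definition dev (k : nat) (H : tmap) : tmap := fun a i =>
  match i return E i with
  | 0 => 0
  | 1 => H a 1%N
  | j.+1 => if (j < k)%N then H a j.+1 - Ext j (truncate j H) a j.+1 else 0
  end.

Definition only_level (m : nat) (I : tmap) : tmap := fun a i =>
  if i == m then I a i else 0.

Definition tmap_add (X Y : tmap) : tmap := fun a i => X a i + Y a i.

Definition tmap_scale (c : R) (X : tmap) : tmap := fun a i => c *: X a i.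

(* The lift of (0, I^1, ..., I^m) for m >= 1, by recursion on m; the value at
   m = 0 is never used, as floor(p) >= 1. *)
Fixpoint lift_upto (I : tmap) (m : nat) : tmap :=
  match m with
  | 0 => fun=> tone
  | 1 => tmap_add (fun=> tone) (only_level 1 I)
  | m'.+1 => tmap_add (Ext m' (lift_upto I m')) (only_level m'.+1 I)
  end.

Definition odot (p : R) (c : R) (H : tmap) : tmap :=
  lift_upto (tmap_scale c (dev (Num.truncn p) H)) (Num.truncn p).

End RoughPaths.

(* Main.v *)
From HB Require Import structures.
Require Import Defs.
From mathcomp Require Import all_boot all_order all_algebra.
From mathcomp Require Import all_classical all_reals all_analysis.
From mathcomp Require Import measurable_realfun exponential_distribution lra ring.

Set Implicit Arguments.
Unset Strict Implicit.
Unset Printing Implicit Defensive.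

Import Order.TTheory GRing.Theory Num.Theory numFieldNormedType.Exports.
Local Open Scope classical_set_scope.
Local Open Scope ring_scope.

(** The development [dev] sends [calH p] into a linear space, injectively, and
    turns [boxplus] and [odot] into pointwise addition and pointwise scaling;
    the vector space axioms can therefore be verified after applying [dev]
    ([vector_space_of_separating_maps]).  Write k for the integer part of p.

    - [dev] is injective ([dev_inj]): level j + 1 of H is level j + 1 of [dev H]
      plus the top level of the extension of (1, H^1, ..., H^j), which is known
      by recursion on j.
    - [dev] is additive ([dev_boxplus]): at each level, [dev] of the sum minus
      the sum of the [dev]'s is an additive function of the interval.  It is
      also O(w^th) for a control w and some th > 1: sewing changes X + Y by such
      an amount only, and the extensions that [dev] subtracts are of this order
      themselves.  An additive function of that order vanishes
      ([additive_bigO_eq0]), since it is the sum of its values along partitions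
      that are arbitrarily fine for w.
    - [dev] commutes with scaling ([dev_odot]) because the lift is a right
      inverse of [dev] on additive functionals ([dev_lift]).

    That the two operations stay in [calH p] ([boxplus_data], [odot_data])
    rests on the existence part of the sewing lemma and of the extension
    theorem.  Both are proved one level at a time.  When the levels up to j of a
    multiplicative functional Z are known, its level j + 1 can be any h with
      h(s,t) = h(s,u) + h(u,t) + sum over 0 < i <= j of
               Z^i(s,u) (x) Z^(j+1-i)(u,t).
    The last sum, [cross_terms], is a cocycle because the tensor product is
    associative ([cross_terms_cocycle]), and [cocycle_sewing] solves such an
    equation with h = O(w^th) as soon as the cocycle is O(w^th) with th > 1.
    This in turn is the sewing of an almost additive function
    ([additive_sewing]).  Uniqueness in both theorems is [chen_unique], an
    induction on the level with [additive_bigO_eq0].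

    The normalizing constants [beta p] and [rfact (i / p)] are positive, so that
    finite p-variation means that level i is O(w^(i/p)); estimates are written
    with the predicate [bigO].  Continuity of the functionals constructed here
    comes from [chen_continuous]. *)

(** * Equalities in abelian groups *)

(* s is a left-associated sum in which the opposite of t occurs: a proof that
   s + t is the sum of the other terms. *)
Ltac zmod_drop s t :=
  lazymatch s with
  | ?s' + ?y =>
    match constr:((y, t)) with
    | (- ?x, ?x) => constr:(subrK x s')
    | (?x, - ?x) => constr:(addrK x s')
    | _ => let e := zmod_drop s' t in
           constr:(etrans (addrAC s' y t) (congr1 (fun z => z + y) e))
    end
  | _ =>
    match constr:((s, t)) with
    | (- ?x, ?x) => constr:(addNr x)
    | (?x, - ?x) => constr:(addrN x)
    end
  end.

(* Moves everything to the left-hand side and cancels the terms in pairs. *)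
Ltac zmod :=
  apply/eqP; rewrite -subr_eq0; apply/eqP;
  rewrite ?(opprD, opprK, oppr0, addrA, addr0, add0r);
  repeat (match goal with |- ?s + ?t = _ =>
            let e := zmod_drop s t in rewrite {1}e ?addr0 ?add0r
          end);
  try reflexivity.

(** * Vector spaces through separating maps *)

(** The zero is 0 times the point x0, the opposite is multiplication by -1, and
    each axiom is inherited from the modules M c because the maps d c separate
    the points of A. *)
Lemma vector_space_of_separating_maps (R : realType) (X : Type) (A : set X)
    (add : X -> X -> X) (scale : R -> X -> X) (x0 : X)
    (C : Type) (M : C -> lmodType R) (d : forall c, X -> M c) :
  A x0 ->
  (forall x y, A x -> A y -> A (add x y)) ->
  (forall a x, A x -> A (scale a x)) ->
  (forall x y, A x -> A y -> (forall c, d c x = d c y) -> x = y) ->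
  (forall c x y, A x -> A y -> d c (add x y) = d c x + d c y) ->
  (forall c a x, A x -> d c (scale a x) = a *: d c x) ->
  is_vector_space A add scale.
Proof.
move=> Ax0 addA scaleA sep dadd dscale.
pose S := set_type A.
have mem (x : S) : A (set_val x) := set_valP x.
pose mk (x : X) (h : A x) : S := SigSub (mem_set h).
pose sadd (x y : S) : S := mk _ (addA _ _ (mem x) (mem y)).
pose sscale a (x : S) : S := mk _ (scaleA a _ (mem x)).
pose z : S := mk _ (scaleA 0 _ Ax0).
have inj (x y : S) : (forall c, d c (set_val x) = d c (set_val y)) -> x = y.
  by move=> h; apply/val_inj/sep => //; exact: mem.
have dz c : d c (set_val z) = 0 by rewrite dscale// scale0r.
have dD c x y : d c (set_val (sadd x y)) = d c (set_val x) + d c (set_val y).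
  by rewrite dadd//; exact: mem.
have dZ c a x : d c (set_val (sscale a x)) = a *: d c (set_val x).
  by rewrite dscale//; exact: mem.
have addrA' : associative sadd by move=> x y w; apply: inj => c; rewrite !dD addrA.
have addrC' : commutative sadd by move=> x y; apply: inj => c; rewrite !dD addrC.
have add0r' : left_id z sadd by move=> x; apply: inj => c; rewrite !dD dz add0r.
have addNr' : left_inverse z (sscale (-1)) sadd.
  by move=> x; apply: inj => c; rewrite !dD dZ dz scaleN1r addNr.
pose Sc : choiceType := HB.pack S (gen_eqMixin S) (gen_choiceMixin S).
pose zm := GRing.isZmodule.Build Sc addrA' addrC' add0r' addNr'.
pose Z : zmodType := HB.pack Sc zm.
have sA a b (v : Z) : sscale a (sscale b v) = sscale (a * b) v.
  by apply: inj => c; rewrite !dZ scalerA.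
have s1 : left_id 1 (sscale : R -> Z -> Z).
  by move=> v; apply: inj => c; rewrite !dZ scale1r.
have sDr : right_distributive (sscale : R -> Z -> Z) +%R.
  by move=> a u v; apply: inj => c; rewrite !(dZ, dD) scalerDr.
have sDl (v : Z) : {morph (sscale^~ v : R -> Z) : a b / a + b}.
  by move=> a b; apply: inj => c; rewrite !(dZ, dD) scalerDl.
pose lm := GRing.Zmodule_isLmodule.Build R Z sA s1 sDr sDl.
pose L : lmodType R := HB.pack Z lm.
by exists (GRing.Lmodule.class L).
Qed.

(** * Positivity of the normalizing constants *)

(** Splitting exp(-t) into two halves, one of them absorbs the power of t.  The
    bound has the shape of the density of the exponential law of rate 1/2, whose
    integral is known. *)
Lemma powR_expR_bound (R : realType) (y : R) : 0 <= y ->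
  exists2 C : R, 0 <= C & forall t, 0 < t -> t `^ y * expR (- t) <= C * expR (- (2^-1) * t).
Proof.
move=> y0; set n := Num.truncn y.
(* From (1 + t)^(n+1) / (2^(n+1) (n+1)!) <= exp ((1 + t) / 2). *)
exists (2 ^+ n.+1 * (n.+1)`!%:R * expR (2^-1)).
  by rewrite !mulr_ge0 ?expR_ge0 ?exprn_ge0.
move=> t t0.
have h1 : t `^ y <= (1 + t) ^+ n.+1.
  apply: (@le_trans _ _ ((1 + t) `^ y)).
    by rewrite ge0_ler_powR ?nnegrE//; lra.
  rewrite -powR_mulrn; last lra.
  by apply: ler_powR; [rewrite lerDl ltW | rewrite ltW ?truncnS_gt].
have h2 : (1 + t) ^+ n.+1 <= 2 ^+ n.+1 * (n.+1)`!%:R * expR ((1 + t) / 2).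
  have := @expR_ge1Dxn R ((1 + t) / 2) n.
  have -> : 0 <= (1 + t) / 2 by lra.
  move=> /(_ isT) h.
  have h3 : ((1 + t) / 2) ^+ n.+1 / n.+1`!%:R <= expR ((1 + t) / 2) by lra.
  move: h3; rewrite ler_pdivrMr ?ltr0n ?fact_gt0// expr_div_n ler_pdivrMr ?exprn_gt0//.
  by rewrite [X in _ <= X -> _]mulrC [X in _ -> _ <= X]mulrAC mulrA (mulrAC (2 ^+ _)).
apply: (@le_trans _ _ (2 ^+ n.+1 * (n.+1)`!%:R * expR ((1 + t) / 2) * expR (- t))).
  by rewrite ler_pM2r ?expR_gt0// (le_trans h1 h2).
rewrite -!mulrA ler_pM2l ?exprn_gt0// ler_pM2l ?ltr0n ?fact_gt0// -!expRD ler_expR.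
lra.
Qed.

Lemma rfact_gt0 (R : realType) (y : R) : 0 <= y -> 0 < rfact y.
Proof.
move=> y0; rewrite /rfact /Gamma addrK /Rintegral.
have [C C0 hC] := powR_expR_bound y0.
have mf : measurable_fun [set: R] (fun t : R => t `^ y * expR (- t)).
  apply: measurable_funM; first exact: measurable_powR.
  by apply: measurableT_comp => //; exact: measurable_expR.
have mF (D : set R) : measurable D -> measurable_fun D (fun t : R => (t `^ y * expR (- t))%:E).
  move=> mD; apply/measurable_EFinP; exact: measurable_funTS.
apply: fine_gt0; apply/andP; split.
  apply: (@lt_le_trans _ _ (\int[lebesgue_measure]_(t in `[1%R, 2%R]) (expR (- 2))%:E)%E).
    rewrite integral_cst//= lebesgue_measure_itv/= lte_fin ltr1n/= -EFinB -EFinM lte_fin.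
    by rewrite mulr_gt0 ?expR_gt0//; lra.
  apply: (@le_trans _ _ (\int[lebesgue_measure]_(t in `[1%R, 2%R]) (t `^ y * expR (- t))%:E)%E).
    apply: ge0_le_integral => //.
    - exact: mF.
    - move=> t /=; rewrite in_itv/= => /andP[t1 t2]; rewrite lee_fin.
      rewrite -[leLHS]mul1r ler_pM ?expR_ge0//; last by rewrite ler_expR lerN2.
      by rewrite -(powRr0 t) ler_powR.
  apply: ge0_subset_integral => //.
  - exact: mF.
  - by move=> t _; rewrite lee_fin mulr_ge0 ?powR_ge0 ?expR_ge0.
  - by move=> t /=; rewrite !in_itv/= andbT => /andP[t1 _]; rewrite (lt_le_trans _ t1).
apply: (@le_lt_trans _ _ (\int[lebesgue_measure]_(t in `]0%R, +oo[) (2 * C * exponential_pdf (2^-1) t)%:E)%E).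
  apply: ge0_le_integral => //.
  - by move=> t _; rewrite lee_fin mulr_ge0 ?powR_ge0 ?expR_ge0.
  - exact: mF.
  - apply/measurable_EFinP; apply: measurable_funM => //.
    exact: (measurable_funTS (measurable_exponential_pdf _)).
  - move=> t /=; rewrite in_itv/= andbT => t0; rewrite lee_fin.
    rewrite exponential_pdfE; last exact: ltW.
    apply: (le_trans (hC _ t0)).
    by rewrite mulrACA divff// mul1r.
under eq_integral do rewrite EFinM.
rewrite ge0_integralZl//; last first.
- by rewrite lee_fin mulr_ge0.
- by move=> t _; rewrite lee_fin exponential_pdf_ge0.
- apply/measurable_EFinP; exact: (measurable_funTS (measurable_exponential_pdf _)).
apply: lte_mul_pinfty; rewrite ?lee_fin ?mulr_ge0//.
apply: (@le_lt_trans _ _ (\int[lebesgue_measure]_t (exponential_pdf (2^-1) t)%:E)%E).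
  apply: ge0_subset_integral => //.
  - apply/measurable_EFinP; exact: measurable_exponential_pdf.
  - by move=> t _; rewrite lee_fin exponential_pdf_ge0.
by rewrite integral_exponential_pdf ?ltry// invr_gt0.
Qed.

(** The terms of the series are nonnegative, hence so is its limit; [limn] of a
    divergent sequence is 0. *)
Lemma beta_gt0 (R : realType) (p : R) : 1 <= p -> 0 < beta p.
Proof.
move=> p1; rewrite /beta mulr_gt0//; first lra.
set u := (X in limn X).
have u0 n : 0 <= u n by apply: sumr_ge0 => i _; exact: powR_ge0.
rewrite ltr_pwDl//.
have [cu|/dvgP->//] := pselect (cvgn u).
by apply: limr_ge => //; near=> n; exact: u0.
Unshelve. all: by end_near. Qed.

(** * Sewing of almost additive functions *)

Section Partitions.
Context (R : realType).

Fixpoint partition_sum (M : zmodType) (A : R -> R -> M) (x : R) (l : seq R) : M :=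
  if l is y :: l' then A x y + partition_sum A y l' else 0.

Lemma partition_sum_cat (M : zmodType) (A : R -> R -> M) x l1 l2 :
  partition_sum A x (l1 ++ l2) = partition_sum A x l1 + partition_sum A (last x l1) l2.
Proof. by elim: l1 x => [|y l IH] x /=; rewrite ?add0r// IH addrA. Qed.

Lemma path_le_last (x : R) l : path <=%R x l -> x <= last x l.
Proof.
by elim: l x => [|y l IH] x //= /andP[xy /IH]; exact: le_trans.
Qed.

Lemma subseq_consP (y : R) l l' : subseq (y :: l) l' ->
  exists p q, l' = p ++ y :: q /\ subseq l q.
Proof.
elim: l' => [//|z l' IH] /=; case: eqP => [->|_] h; first by exists [::], l'.
by have [p [q [-> hq]]] := IH h; exists (z :: p), q.
Qed.

(** Used with f = w(x, _) and c half of the total control: the points of the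
    partition before and after the crossing span intervals of control at most c,
    which is what makes a divide-and-conquer estimate possible. *)
Lemma split_at_threshold (f : R -> R) (c z : R) l : f z <= c -> l != [::] ->
  exists l1 y l2,
    [/\ l = l1 ++ y :: l2, f (last z l1) <= c & c <= f y \/ l2 = [::]].
Proof.
elim: l z => [//|y [|y' l] IH] z fz _; first by exists [::], y, [::]; split=> //; right.
have [cy|/ltW yc] := leP c (f y); first by exists [::], y, (y' :: l); split=> //; left.
have [//|l1 [u [l2 [-> h1 h2]]]] := IH y yc.
by exists (y :: l1), u, l2.
Qed.

(** The common refinement of two partitions of the same interval. *)
Lemma last_sort_cat (x e : R) l1 l2 : path <=%R x l1 -> path <=%R x l2 ->
  last x l1 = e -> last x l2 = e ->
  let m := sort <=%R (l1 ++ l2) in path <=%R x m /\ last x m = e.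
Proof.
move=> p1 p2 e1 e2 m.
have ub (z : R) l y : path <=%R z l -> y \in z :: l -> y <= last z l.
  elim: l z => [|a l IH] z /=; first by rewrite mem_seq1 => _ /eqP->.
  move=> /andP[za pa]; rewrite inE => /orP[/eqP->|]; last exact: IH.
  exact: le_trans za (path_le_last pa).
have lb (z : R) l y : path <=%R z l -> y \in l -> z <= y.
  by move=> /(order_path_min le_trans)/allP; exact.
have pm : path <=%R x m.
  rewrite path_min_sorted ?sort_le_sorted//.
  apply/allP => y; rewrite mem_sort mem_cat => /orP[]; exact: lb.
split=> //; apply/eqP; rewrite eq_le; apply/andP; split.
  have := mem_last x m; rewrite inE => /orP[/eqP->|].
    by rewrite -e1 path_le_last.
  rewrite mem_sort mem_cat => /orP[] h.
    by rewrite -e1 ub// inE h orbT.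
  by rewrite -e2 ub// inE h orbT.
apply: ub => //; have := mem_last x l1.
by rewrite e1 !inE mem_sort mem_cat => /orP[->//|->]; rewrite orbT.
Qed.

End Partitions.

Lemma geometric_small (R : realType) (c q e : R) : 0 <= q < 1 -> 0 < e ->
  exists N, c * q ^+ N < e.
Proof.
move=> /andP[q0 q1] e0.
have /cvgr0_norm_lt/(_ _ e0)[N _ hN] : geometric c q @ \oo --> (0 : R).
  by apply: cvg_geometric; rewrite ger0_norm.
by exists N; apply: le_lt_trans (ler_norm _) (hN N _) => /=.
Qed.

Lemma geometric_le0 (R : realType) (a c q : R) : 0 <= q < 1 ->
  (forall n, a <= c * q ^+ n) -> a <= 0.
Proof.
move=> q01 h; have [//|a0] := leP a 0.
have [N] := geometric_small c q01 a0.
by rewrite ltNge h.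
Qed.

(** Completeness, with the explicit rate of convergence. *)
Lemma geometric_cauchy_limit (R : realType) (W : completeNormedModType R)
    (b : nat -> W) (c q : R) : 0 <= q < 1 ->
  (forall m n, (m <= n)%N -> `|b m - b n| <= c * q ^+ m) ->
  exists l, forall n, `|l - b n| <= c * q ^+ n.
Proof.
move=> q01 hb.
have /cauchy_cvgP bl : cauchy (b @ \oo).
  apply: cauchy_exP => e e0; have [N hN] := geometric_small c q01 e0.
  exists (b N), N => // n /= Nn; rewrite /= -ball_normE /=.
  exact: le_lt_trans (hb _ _ Nn) hN.
exists (lim (b @ \oo)) => n; apply/ler_addgt0Pr => e e0.
have /cvgrPdist_lt/(_ _ e0)[N _ hN] := bl.
have := hN (maxn n N) (leq_maxr _ _) => /ltW h1.
have h2 := hb _ _ (leq_maxl n N).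
rewrite -(subrKA (b (maxn n N))) (le_trans (ler_normD _ _))// addrC lerD//.
by rewrite distrC.
Qed.

Section AdditiveSewing.
Context (R : realType) (W : completeNormedModType R) (S T : R).
Context (w : R -> R -> R) (th : R).
Hypothesis th1 : 1 < th.
Hypothesis w0 : forall s t, S <= s -> s <= t -> t <= T -> 0 <= w s t.
Hypothesis wdiag : forall s, S <= s -> s <= T -> w s s = 0.
Hypothesis wsup : forall s u t, S <= s -> s <= u -> u <= t -> t <= T ->
  w s u + w u t <= w s t.
(* Midpoints of the control; they come from its continuity. *)
Hypothesis wmid : forall s t, S <= s -> s <= t -> t <= T ->
  exists u, [/\ s <= u, u <= t, w s u <= w s t / 2 & w u t <= w s t / 2].

Let th0 : 0 < th. Proof. exact: lt_trans th1. Qed.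

Lemma control_le s s' t' t : S <= s -> s <= s' -> s' <= t' -> t' <= t -> t <= T ->
  w s' t' <= w s t.
Proof.
move=> h1 h2 h3 h4 h5.
have a1 := wsup h1 h2 (le_trans h3 h4) h5.
have a2 := wsup (le_trans h1 h2) h3 h4 h5.
have a3 := w0 h1 h2 (le_trans h3 (le_trans h4 h5)).
have a4 := w0 (le_trans h1 (le_trans h2 h3)) h4 h5.
lra.
Qed.

Lemma controlX_le s s' t' t : S <= s -> s <= s' -> s' <= t' -> t' <= t -> t <= T ->
  w s' t' `^ th <= w s t `^ th.
Proof.
move=> h1 h2 h3 h4 h5; apply: ge0_ler_powR; rewrite ?nnegrE ?(ltW th0)//.
- by apply: w0 => //; lra.
- by apply: w0 => //; lra.
- exact: control_le.
Qed.

(* h and q are the factors gained by w^th and by w^(th-1) when w is halved. *)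
Let h : R := 2^-1 `^ th.
Let q : R := 2^-1 `^ (th - 1).

Let q_lt1 : 0 <= q < 1.
Proof.
rewrite powR_ge0 /=.
have := @gt0_ltr_powR R (th - 1); rewrite subr_gt0 => /(_ th1 2^-1 1).
rewrite !nnegrE powR1; apply => //; lra.
Qed.

Let hE : h = q / 2.
Proof. by rewrite /h /q -(@mulr_powRB1 _ _ th)// mulrC. Qed.

Lemma partition_sum_control x l : S <= x -> path <=%R x l -> last x l <= T ->
  partition_sum w x l <= w x (last x l).
Proof.
elim: l x => [|y l IH] x Sx /=; first by move=> _ xT; rewrite wdiag.
move=> /andP[xy pl] lT.
have Sy := le_trans Sx xy; have yl := path_le_last pl.
apply: le_trans (wsup Sx xy yl lT).
by rewrite lerD2l IH.
Qed.

Definition fine_mesh (e : R) : rel R := fun s t => (s <= t) && (w s t <= e).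

Lemma fine_path e x l : path (fine_mesh e) x l -> path <=%R x l.
Proof. by apply: sub_path => s t /andP[]. Qed.

(** Writing w^th as w^(th-1) w, the first factor is small on a fine partition and
    the second sums up to at most the total control. *)
Lemma partition_sum_controlX e x l : 0 <= e -> S <= x -> path (fine_mesh e) x l ->
  last x l <= T ->
  partition_sum (fun s t => w s t `^ th) x l <= e `^ (th - 1) * w x (last x l).
Proof.
move=> e0 Sx pl lT; apply: (@le_trans _ _ (e `^ (th - 1) * partition_sum w x l)); last first.
  by rewrite ler_wpM2l ?powR_ge0// partition_sum_control// (fine_path pl).
elim: l x Sx pl lT => [|y l IH] x Sx /=; first by rewrite mulr0.
move=> /andP[/andP[xy wxy] pl] lT.
have Sy := le_trans Sx xy; have yl := path_le_last (fine_path pl).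
have wxy0 := w0 Sx xy (le_trans yl lT).
rewrite mulrDr lerD ?IH// -(mulr_powRB1 wxy0 th0) mulrC ler_wpM2r//.
by rewrite ge0_ler_powR ?nnegrE// subr_ge0 ltW.
Qed.

(** Bisection at midpoints of the control, n times. *)
Lemma fine_partition n s t : S <= s -> s <= t -> t <= T ->
  exists l, path (fine_mesh (w s t * 2^-1 ^+ n)) s l /\ last s l = t.
Proof.
elim: n s t => [|n IH] s t Ss st tT.
  by exists [:: t]; rewrite /= /fine_mesh st expr0 mulr1 lexx.
have [u [su ut wsu wut]] := wmid Ss st tT.
have [l1 [p1 e1]] := IH _ _ Ss su (le_trans ut tT).
have [l2 [p2 e2]] := IH _ _ (le_trans Ss su) ut tT.
exists (l1 ++ l2); rewrite last_cat e1 e2; split=> //.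
have mono a l z : a <= w s t / 2 -> path (fine_mesh (a * 2^-1 ^+ n)) z l ->
    path (fine_mesh (w s t * 2^-1 ^+ n.+1)) z l.
  move=> ha; apply: sub_path => x y /andP[xy wxy]; rewrite /fine_mesh xy/=.
  by rewrite (le_trans wxy)// exprS mulrA ler_wpM2r// exprn_ge0.
by rewrite cat_path e1 (mono _ _ _ wsu p1) (mono _ _ _ wut p2).
Qed.

Section AlmostAdditive.
Context (A : R -> R -> W) (K : R).
Hypothesis K0 : 0 <= K.
Hypothesis hA : forall s u t, S <= s -> s <= u -> u <= t -> t <= T ->
  `|A s u + A u t - A s t| <= K * w s t `^ th.

Let C : R := 2 * K / (1 - q).

Let C_ge0 : 0 <= C.
Proof.
have /andP[q0 q1] := q_lt1.
by rewrite /C divr_ge0 ?mulr_ge0// subr_ge0 ltW.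
Qed.

Lemma almost_additive_diag s : S <= s -> s <= T -> A s s = 0.
Proof.
move=> Ss sT; apply/eqP; rewrite -normr_le0.
have := hA Ss (lexx s) (lexx s) sT; rewrite addrK wdiag// powR0 ?mulr0//.
by rewrite gt_eqF.
Qed.

(** The maximal inequality: the constant does not depend on the number of points.
    The partition is cut at the interval where the control from the left end
    crosses half of its total W, and the induction hypothesis is applied on both
    sides.  Each of the two sides contributes C (W/2)^th, and inserting the two
    cut points costs 2 K W^th, so that C only has to satisfy
    2 (1/2)^th C + 2 K = C; this is possible because th > 1. *)
Lemma partition_sum_bound l x : S <= x -> path <=%R x l -> last x l <= T ->
  `|partition_sum A x l - A x (last x l)| <= C * w x (last x l) `^ th.
Proof.
have [n] := ubnP (size l); elim: n l x => // n IH l x sl Sx pl lT.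
have xl := path_le_last pl; have xT := le_trans xl lT.
have [l0|l0] := eqVneq l [::].
  rewrite l0 /= sub0r normrN almost_additive_diag// normr0.
  by rewrite mulr_ge0 ?C_ge0 ?powR_ge0.
set e := last x l; set c := w x e / 2.
have we0 : 0 <= w x e := w0 Sx xl lT.
have [|//|l1 [y [l2 [El h1 h2]]]] := @split_at_threshold R (w x) c x l.
  by rewrite wdiag ?divr_ge0.
move: pl sl; rewrite El cat_path /= size_cat /= => /and3P[p1 zy p2].
rewrite addnS ltnS => sl.
set z := last x l1 in h1 zy *.
have Ee : e = last y l2 by rewrite /e El last_cat.
have xz : x <= z := path_le_last p1.
have ye : y <= e by rewrite Ee path_le_last.
have Sz := le_trans Sx xz; have Sy := le_trans Sz zy; have ze := le_trans zy ye.
have wye : w y e <= c.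
  case: h2 => [cy|l20].
    have := wsup Sx (le_trans xz zy) ye lT; rewrite /c in cy *; lra.
  by rewrite Ee l20 /= wdiag ?divr_ge0// (le_trans ye).
rewrite partition_sum_cat /= -/z.
have b1 := IH l1 x; rewrite -/z in b1.
have b2 := IH l2 y; rewrite -Ee in b2.
have {}b1 : `|partition_sum A x l1 - A x z| <= C * (h * w x e `^ th).
  apply: (le_trans (b1 _ Sx p1 (le_trans ze lT))).
    exact: leq_ltn_trans (leq_addr _ _) sl.
  rewrite ler_wpM2l ?C_ge0// /h -powRM// mulrC ge0_ler_powR ?nnegrE ?(ltW th0)//.
    by rewrite w0// (le_trans ze).
  by rewrite mulr_ge0.
have {}b2 : `|partition_sum A y l2 - A y e| <= C * (h * w x e `^ th).
  apply: (le_trans (b2 _ Sy p2 lT)).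
    exact: leq_ltn_trans (leq_addl _ _) sl.
  rewrite ler_wpM2l ?C_ge0// /h -powRM// mulrC ge0_ler_powR ?nnegrE ?(ltW th0)//.
    by rewrite w0.
  by rewrite mulr_ge0.
have b3 := hA Sx xz ze lT.
have b4 : `|A z y + A y e - A z e| <= K * w x e `^ th.
  apply: (le_trans (hA Sz zy ye lT)); rewrite ler_wpM2l// controlX_le//.
have -> : partition_sum A x l1 + (A z y + partition_sum A y l2) - A x e =
  (partition_sum A x l1 - A x z) + (partition_sum A y l2 - A y e)
    + ((A x z + A z e - A x e) + (A z y + A y e - A z e)).
  by zmod.
apply: (le_trans (ler_normD _ _)).
apply: (le_trans (lerD (ler_normD _ _) (ler_normD _ _))).
apply: (le_trans (lerD (lerD b1 b2) (lerD b3 b4))).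
have /andP[q0 q1] := q_lt1.
have -> : C * (h * w x e `^ th) + C * (h * w x e `^ th) + (K * w x e `^ th + K * w x e `^ th)
  = (C * q + 2 * K) * w x e `^ th by rewrite hE; field.
suff -> : C * q + 2 * K = C by [].
rewrite /C; field; lra.
Qed.

(** The maximal inequality on each interval of the coarser partition. *)
Lemma partition_sum_refine l' l x : S <= x -> path <=%R x l' -> subseq l l' ->
  last x l = last x l' -> last x l' <= T ->
  `|partition_sum A x l - partition_sum A x l'| <= C * partition_sum (fun s t => w s t `^ th) x l.
Proof.
elim: l l' x => [|y l IH] l' x Sx pl' sl el lT.
  have xT : x <= T := le_trans (path_le_last pl') lT.
  rewrite /= in el *; have := partition_sum_bound Sx pl' lT.
  rewrite -el almost_additive_diag// wdiag// powR0 ?gt_eqF// subr0 sub0r normrN.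
  by [].
have [l1 [l2 [El sl2]]] := subseq_consP sl.
move: pl' el lT; rewrite El -cat_rcons cat_path last_cat last_rcons => /andP[p1 p2] /= el lT.
have xy : x <= y by have := path_le_last p1; rewrite last_rcons.
have Sy := le_trans Sx xy.
have yT : y <= T by rewrite (le_trans (path_le_last p2)).
rewrite partition_sum_cat last_rcons mulrDr.
have b1 := partition_sum_bound Sx p1; rewrite last_rcons in b1.
have b2 := IH _ _ Sy p2 sl2 el lT.
have -> : A x y + partition_sum A y l - (partition_sum A x (rcons l1 y) + partition_sum A y l2)
  = (partition_sum A y l - partition_sum A y l2) - (partition_sum A x (rcons l1 y) - A x y) by zmod.
by rewrite (le_trans (ler_normB _ _))// addrC lerD// b1.
Qed.

(** Both sums are compared with the sum along a common refinement. *)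
Lemma partition_sum_fine_close s t n l1 l2 : S <= s -> t <= T ->
  path (fine_mesh (w s t * 2^-1 ^+ n)) s l1 -> last s l1 = t ->
  path (fine_mesh (w s t * 2^-1 ^+ n)) s l2 -> last s l2 = t ->
  `|partition_sum A s l1 - partition_sum A s l2| <= 2 * C * w s t `^ th * q ^+ n.
Proof.
move=> Ss tT p1 e1 p2 e2.
have p1' := fine_path p1; have p2' := fine_path p2.
have st : s <= t by rewrite -e1 path_le_last.
have [pm em] := last_sort_cat p1' p2' e1 e2; set m := sort _ _ in pm em.
have wst := w0 Ss st tT.
have key l : path (fine_mesh (w s t * 2^-1 ^+ n)) s l -> last s l = t ->
    subseq l m -> `|partition_sum A s l - partition_sum A s m| <= C * w s t `^ th * q ^+ n.
  move=> pl el sl; apply: le_trans (partition_sum_refine Ss pm sl _ _) _.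
  - by rewrite el em.
  - by rewrite em.
  rewrite -mulrA ler_wpM2l ?C_ge0//.
  have e0 : 0 <= w s t * 2^-1 ^+ n by rewrite mulr_ge0// exprn_ge0.
  apply: le_trans (partition_sum_controlX e0 Ss pl _) _; first by rewrite el.
  have qn : (2^-1 ^+ n) `^ (th - 1) = q ^+ n.
    by rewrite /q -!powR_mulrn ?powR_ge0 ?invr_ge0// powRAC.
  by rewrite el powRM ?exprn_ge0// qn -(mulr_powRB1 wst th0) mulrC mulrA.
have b1 := key _ p1 e1 (sorted_subseq_sort_le (prefix_subseq _ _) (path_sorted p1')).
have b2 := key _ p2 e2 (sorted_subseq_sort_le (suffix_subseq _ _) (path_sorted p2')).
rewrite -(subrKA (partition_sum A s m)) (le_trans (ler_normD _ _))//.
rewrite -normrN opprB in b2.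
lra.
Qed.

(** B is the limit of the Riemann sums of A along finer and finer partitions.  The
    partitions chosen for [s,u] and [u,t] together form a fine partition of
    [s,t], and sums along fine partitions are close to each other: this gives the
    additivity of B. *)
Lemma additive_sewing : exists B : R -> R -> W,
  (forall s u t, S <= s -> s <= u -> u <= t -> t <= T -> B s u + B u t = B s t) /\
  exists2 c, 0 <= c & forall s t, S <= s -> s <= t -> t <= T ->
    `|B s t - A s t| <= c * w s t `^ th.
Proof.
pose P n s t := [set l | path (fine_mesh (w s t * 2^-1 ^+ n)) s l /\ last s l = t].
pose b s t n := partition_sum A s (xget [::] (P n s t)).
have Pn n s t : S <= s -> s <= t -> t <= T -> P n s t (xget [::] (P n s t)).
  by move=> h1 h2 h3; have [l hl] := fine_partition n h1 h2 h3;
     exact: (@xgetPex _ [::] (P n s t) (ex_intro _ l hl)).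
have coarser m n s t l : S <= s -> s <= t -> t <= T -> (m <= n)%N ->
    path (fine_mesh (w s t * 2^-1 ^+ n)) s l -> path (fine_mesh (w s t * 2^-1 ^+ m)) s l.
  move=> h1 h2 h3 mn; apply: sub_path => x y /andP[xy wxy]; rewrite /fine_mesh xy/=.
  rewrite (le_trans wxy)// ler_wpM2l ?w0// ler_wiXn2l//; lra.
pose D s t := 2 * C * w s t `^ th.
have lim s t : S <= s -> s <= t -> t <= T ->
    exists l, forall n, `|l - b s t n| <= D s t * q ^+ n.
  move=> h1 h2 h3; apply: geometric_cauchy_limit q_lt1 _ => m n mn.
  have [p1 e1] := Pn m _ _ h1 h2 h3; have [p2 e2] := Pn n _ _ h1 h2 h3.
  exact: partition_sum_fine_close (coarser _ _ _ _ _ h1 h2 h3 mn p2) _.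
pose B s t := xget 0 [set l | forall n, `|l - b s t n| <= D s t * q ^+ n].
have hB s t n : S <= s -> s <= t -> t <= T -> `|B s t - b s t n| <= D s t * q ^+ n.
  move=> h1 h2 h3; have [l hl] := lim _ _ h1 h2 h3.
  exact: (@xgetPex _ 0 [set l | forall n, `|l - b s t n| <= D s t * q ^+ n] (ex_intro _ l hl)).
exists B; split; last first.
  exists (3 * C) => [|s t Ss st tT]; first by rewrite mulr_ge0 ?C_ge0.
  have := hB s t 0 Ss st tT; rewrite expr0 mulr1 => h1.
  have [p1 e1] := Pn 0 _ _ Ss st tT.
  have := partition_sum_bound Ss (fine_path p1); rewrite e1 => /(_ tT) h2.
  rewrite -(subrKA (b s t 0)) (le_trans (ler_normD _ _))// (le_trans (lerD h1 h2))//.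
  by rewrite /D -!mulrDl; lra.
move=> s u t Ss su ut tT.
have st := le_trans su ut; have Su := le_trans Ss su; have uT := le_trans ut tT.
apply/eqP; rewrite -subr_eq0 -normr_le0.
apply: (@geometric_le0 _ _ (4 * D s t) _ q_lt1) => n.
have [p1 e1] := Pn n _ _ Ss su uT; have [p2 e2] := Pn n _ _ Su ut tT.
have [p3 e3] := Pn n _ _ Ss st tT.
have fineW s' t' z l : S <= s -> s <= s' -> s' <= t' -> t' <= t ->
    path (fine_mesh (w s' t' * 2^-1 ^+ n)) z l -> path (fine_mesh (w s t * 2^-1 ^+ n)) z l.
  move=> h0 h1 h2 h3; apply: sub_path => x y /andP[xy wxy]; rewrite /fine_mesh xy/=.
  by rewrite (le_trans wxy)// ler_wpM2r ?exprn_ge0// control_le.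
have b3 : `|b s u n + b u t n - b s t n| <= D s t * q ^+ n.
  have := @partition_sum_fine_close s t n _ _ Ss tT _ _ p3 e3.
  move=> /(_ (xget [::] (P n s u) ++ xget [::] (P n u t))).
  rewrite partition_sum_cat e1 last_cat e1; apply=> //.
  rewrite cat_path e1 (fineW s u)//=; exact: (fineW u t).
have Dle s' t' : s <= s' -> s' <= t' -> t' <= t -> D s' t' * q ^+ n <= D s t * q ^+ n.
  move=> h1 h2 h3; have /andP[q0 _] := q_lt1.
  by rewrite ler_wpM2r ?exprn_ge0// /D ler_wpM2l ?(mulr_ge0 _ C_ge0)// controlX_le.
have b1 := le_trans (hB s u n Ss su uT) (Dle _ _ (lexx s) su ut).
have b2 := le_trans (hB u t n Su ut tT) (Dle _ _ su ut (lexx t)).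
have b0 := hB s t n Ss st tT.
have -> : B s u + B u t - B s t = ((B s u - b s u n) + (B u t - b u t n)) +
   ((b s u n + b u t n - b s t n) - (B s t - b s t n)) by zmod.
rewrite (le_trans (ler_normD _ _))// (le_trans (lerD (ler_normD _ _) (ler_normB _ _)))//.
rewrite (le_trans (lerD (lerD b1 b2) (lerD b3 b0)))// -mulrA; lra.
Qed.

End AlmostAdditive.

(** An additive function is the sum of its values along any partition, and these
    sums tend to 0 along fine partitions. *)
Lemma small_additive_eq0 (D : R -> R -> W) (K : R) : 0 <= K ->
  (forall s u t, S <= s -> s <= u -> u <= t -> t <= T -> D s u + D u t = D s t) ->
  (forall s t, S <= s -> s <= t -> t <= T -> `|D s t| <= K * w s t `^ th) ->
  forall s t, S <= s -> s <= t -> t <= T -> D s t = 0.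
Proof.
move=> K0 addD hD s t Ss st tT; apply/eqP; rewrite -normr_le0.
apply: (@geometric_le0 _ _ (K * w s t `^ th) _ q_lt1) => n.
have [l [pl el]] := fine_partition n Ss st tT.
have e0 : 0 <= w s t * 2^-1 ^+ n by rewrite mulr_ge0 ?w0// exprn_ge0.
have Dss x : S <= x -> x <= T -> D x x = 0.
  move=> Sx xT; have /eqP := addD _ _ _ Sx (lexx x) (lexx x) xT.
  by rewrite -subr_eq0 addrK => /eqP.
have -> : D s t = partition_sum D s l.
  rewrite -el in tT *; elim: l s Ss tT {st pl el e0} (fine_path pl) => [|y l IH] x Sx /=.
    by move=> xT _; exact: Dss.
  move=> lT /andP[xy pl]; have yl := path_le_last pl.
  by rewrite -IH ?(le_trans Sx)// addD.
apply: (@le_trans _ _ (K * partition_sum (fun s t => w s t `^ th) s l)).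
  rewrite -el in tT; elim: l s Ss tT {st el e0 pl} (fine_path pl) => [|y l IH] x Sx /=.
    by rewrite normr0 mulr0.
  move=> lT /andP[xy pl]; have yl := path_le_last pl.
  rewrite mulrDr (le_trans (ler_normD _ _))// lerD//.
    by rewrite hD// (le_trans yl).
  exact: IH (le_trans Sx xy) lT pl.
rewrite -mulrA ler_wpM2l//.
apply: le_trans (partition_sum_controlX e0 Ss pl _) _; first by rewrite el.
have qn : (2^-1 ^+ n) `^ (th - 1) = q ^+ n.
  by rewrite /q -!powR_mulrn ?powR_ge0 ?invr_ge0// powRAC.
have wst := w0 Ss st tT.
by rewrite el powRM ?exprn_ge0// qn -(mulr_powRB1 wst th0) mulrC mulrA.
Qed.

End AdditiveSewing.

(** * Graded tensor products *)

Section Tensors.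
Context (R : realType) (V : completeNormedModType R) (E : tensor_powers V).

(** Elementary tensors span a dense subspace. *)
Lemma bounded_linear_eq0 n (W : normedModType R) (f : E n -> W) (C : R) :
  linear f -> (forall x, `|f x| <= C * `|x|) -> (forall v, f (pure E v) = 0) ->
  forall x, f x = 0.
Proof.
move=> lf bf f0 x.
pose g : {linear E n -> W} := HB.pack f (GRing.isLinear.Build _ _ _ _ f lf).
apply/eqP; rewrite -normr_le0; apply/ler_addgt0Pr => e e0; rewrite add0r.
have C0 : 0 < `|C| + 1 by rewrite ltr_wpDl.
have [y [xy [m [c [v Ey]]]]] : ball x (e / (`|C| + 1)) `&`
   [set x : E n | exists (m : nat) (c : 'I_m -> R) (v : 'I_m -> 'I_n -> V),
       x = \sum_i c i *: pure E (v i)] !=set0.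
  apply: (@pure_dense _ _ E n); last exact: ball_open.
  by exists x; apply: ballxx; rewrite divr_gt0.
have fy : f y = 0.
  rewrite -[f]/(g : _ -> _) Ey linear_sum big1// => i _.
  by rewrite linearZ /= f0 scaler0.
have -> : f x = f (x - y) by rewrite -[f]/(g : _ -> _) linearB /= fy subr0.
apply: (le_trans (bf _)); apply: (@le_trans _ _ ((`|C| + 1) * `|x - y|)).
  by rewrite ler_wpM2r// (le_trans (ler_norm C))// lerDl.
by move: xy; rewrite -ball_normE /= => xy; rewrite mulrC -ler_pdivlMr// ltW.
Qed.

(** Keeping n independent of i and j allows sums over all pairs of levels to be
    written and exchanged without transporting terms along i + j = n. *)
Definition tens_at (n i j : nat) (x : E i) (y : E j) : E n :=
  match i + j =P n with
  | ReflectT e => ecast l (E l) e (tens x y)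
  | ReflectF _ => 0
  end.

Lemma tens_atE n i j (e : (i + j)%N = n) (x : E i) (y : E j) :
  tens_at n x y = ecast l (E l) e (tens x y).
Proof. by rewrite /tens_at; case: eqP => // e'; rewrite (eq_irrelevance e e'). Qed.

Lemma tens_at_add i j (x : E i) (y : E j) : tens_at (i + j) x y = tens x y.
Proof. by rewrite (tens_atE erefl). Qed.

Lemma tens_at_eq0 n i j (x : E i) (y : E j) : (i + j)%N != n -> tens_at n x y = 0.
Proof. by rewrite /tens_at; case: eqP. Qed.

Lemma tens_at_linearl n i j (y : E j) : linear (fun x : E i => tens_at n x y).
Proof.
move=> a x x'; have [<-|ne] := eqVneq (i + j)%N n.
  by rewrite !tens_at_add tens_linearl.
by rewrite !tens_at_eq0// scaler0 addr0.
Qed.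

Lemma tens_at_linearr n i j (x : E i) : linear (fun y : E j => tens_at n x y).
Proof.
move=> a y y'; have [<-|ne] := eqVneq (i + j)%N n.
  by rewrite !tens_at_add tens_linearr.
by rewrite !tens_at_eq0// scaler0 addr0.
Qed.

Definition tens_atr n i j (y : E j) (x : E i) : E n := tens_at n x y.

HB.instance Definition _ n i j (y : E j) :=
  GRing.isLinear.Build _ _ _ _ (@tens_atr n i j y) (@tens_at_linearl n i j y).
HB.instance Definition _ n i j (x : E i) :=
  GRing.isLinear.Build _ _ _ _ (@tens_at n i j x) (@tens_at_linearr n i j x).

Lemma tens_atDl n i j (x x' : E i) (y : E j) :
  tens_at n (x + x') y = tens_at n x y + tens_at n x' y.
Proof. exact: (linearD (@tens_atr n i j y)). Qed.

Lemma tens_atDr n i j (x : E i) (y y' : E j) :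
  tens_at n x (y + y') = tens_at n x y + tens_at n x y'.
Proof. exact: linearD. Qed.

Lemma tens_at0l n i j (y : E j) : tens_at n (0 : E i) y = 0.
Proof. exact: (linear0 (@tens_atr n i j y)). Qed.

Lemma tens_at0r n i j (x : E i) : tens_at n x (0 : E j) = 0.
Proof. exact: linear0. Qed.

Lemma tens_at_suml n i j (I : Type) (r : seq I) (F : I -> E i) (y : E j) :
  tens_at n (\sum_(l <- r) F l) y = \sum_(l <- r) tens_at n (F l) y.
Proof. exact: (linear_sum (@tens_atr n i j y)). Qed.

Lemma tens_at_sumr n i j (I : Type) (r : seq I) (x : E i) (F : I -> E j) :
  tens_at n x (\sum_(l <- r) F l) = \sum_(l <- r) tens_at n x (F l).
Proof. exact: linear_sum. Qed.

Lemma norm_tens_at n i j (x : E i) (y : E j) : `|tens_at n x y| <= `|x| * `|y|.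
Proof.
have [<-|ne] := eqVneq (i + j)%N n; first by rewrite tens_at_add norm_tens.
by rewrite tens_at_eq0// normr0 mulr_ge0.
Qed.

Lemma tens_at_pure n i j (e : (i + j)%N = n) (u : 'I_i -> V) (v : 'I_j -> V) :
  tens_at n (pure E u) (pure E v) = pure E (fam_cat u v \o cast_ord (esym e)).
Proof.
case: _ / e; rewrite tens_at_add tens_pure; congr (pure E _).
by apply/funext => a /=; rewrite cast_ord_id.
Qed.

Lemma fam_cat_assoc n i j k (e1 : (i + j + k)%N = n) (e2 : (i + (j + k))%N = n)
    (u : 'I_i -> V) (v : 'I_j -> V) (x : 'I_k -> V) :
  fam_cat (fam_cat u v) x \o cast_ord (esym e1)
  = fam_cat u (fam_cat v x) \o cast_ord (esym e2).
Proof.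
apply/funext => a /=; rewrite /fam_cat.
case: fintype.splitP => b /= Eb; case: fintype.splitP => c /= Ec.
- case: fintype.splitP => d /= Ed.
    by congr u; apply/val_inj; rewrite /= -Ed -Ec Eb.
  by exfalso; have := ltn_ord c; rewrite -Ec -Eb Ed ltnNge leq_addr.
- case: fintype.splitP => d /= Ed.
    by exfalso; have := ltn_ord d; rewrite -Ed Eb Ec ltnNge leq_addr.
  case: fintype.splitP => f /= Ef.
    by congr v; apply/val_inj => /=; apply/eqP; rewrite -(eqn_add2l i) -Ec -Ef -Ed Eb.
  exfalso; have := ltn_ord c.
  by rewrite -(ltn_add2l i) -Ec -Eb Ed Ef ltn_add2l ltnNge leq_addr.
- by exfalso; have := ltn_ord c; rewrite -Ec Eb -addnA ltnNge leq_addr.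
- case: fintype.splitP => d /= Ed.
    exfalso; have := ltn_ord d.
    by rewrite -(ltn_add2l i) -Ed -Ec Eb ltnNge leq_addr.
  congr x; apply/val_inj => /=; apply/eqP.
  by rewrite -(eqn_add2l (i + j)%N) -Eb Ec Ed addnA.
Qed.

(** By continuity and linearity in each argument it suffices to check this on
    elementary tensors, where it is the associativity of concatenation. *)
Lemma tens_atA n i j k (x : E i) (y : E j) (z : E k) :
  tens_at n (tens_at (i + j) x y) z = tens_at n x (tens_at (j + k) y z).
Proof.
have [e1|ne] := eqVneq (i + j + k)%N n; last first.
  by rewrite (tens_at_eq0 _ _ ne) tens_at_eq0 ?addnA.
have e2 : (i + (j + k))%N = n by rewrite addnA.
apply/eqP; rewrite -subr_eq0; apply/eqP.
have bnd (x' : E i) (y' : E j) (z' : E k) :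
    `|tens_at n (tens_at (i + j) x' y') z' - tens_at n x' (tens_at (j + k) y' z')|
     <= 2 * (`|x'| * `|y'| * `|z'|).
  rewrite mulr2n mulrDl mul1r (le_trans (ler_normB _ _))// lerD//.
    by rewrite (le_trans (norm_tens_at _ _ _))// ler_wpM2r// norm_tens_at.
  by rewrite (le_trans (norm_tens_at _ _ _))// -mulrA ler_wpM2l// norm_tens_at.
have lcomb (W : lmodType R) (a : R) (x1 x2 x3 x4 : W) :
  a *: x1 + x2 - (a *: x3 + x4) = a *: (x1 - x3) + (x2 - x4).
  by rewrite scalerBr opprD addrACA.
apply: (@bounded_linear_eq0 _ _
  (fun x => tens_at n (tens_at (i + j) x y) z -
     tens_at n x (tens_at (j + k) y z)) (2 * (`|y| * `|z|))) x.
- by move=> a x1 x2; rewrite !tens_at_linearl lcomb.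
- by move=> x'; rewrite (le_trans (bnd _ _ _))// -!mulrA [`|x'| * _]mulrC !mulrA.
move=> u.
apply: (@bounded_linear_eq0 _ _
  (fun y => tens_at n (tens_at (i + j) (pure E u) y) z -
     tens_at n (pure E u) (tens_at (j + k) y z)) (2 * (`|pure E u| * `|z|))) y.
- by move=> a x1 x2; rewrite !(tens_at_linearl, tens_at_linearr) lcomb.
- by move=> x'; rewrite (le_trans (bnd _ _ _))// -!mulrA [`|x'| * _]mulrC !mulrA.
move=> v.
apply: (@bounded_linear_eq0 _ _
  (fun z => tens_at n (tens_at (i + j) (pure E u) (pure E v)) z -
     tens_at n (pure E u) (tens_at (j + k) (pure E v) z)) (2 * (`|pure E u| * `|pure E v|))) z.
- by move=> a x1 x2; rewrite !(tens_at_linearl, tens_at_linearr) lcomb.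
- by move=> x'; rewrite (le_trans (bnd _ _ _))// -!mulrA.
move=> x'.
by rewrite !tens_at_add !tens_pure (tens_at_pure e1) (tens_at_pure e2) fam_cat_assoc subrr.
Qed.

Lemma tens_at1l n (y : E n) : tens_at n (tone0 E) y = y.
Proof.
apply/eqP; rewrite -subr_eq0; apply/eqP.
apply: (@bounded_linear_eq0 _ _ (fun y => tens_at n (tone0 E) y - y) 2) y.
- by move=> a x1 x2; rewrite tens_at_linearr scalerBr opprD addrACA.
- move=> x; rewrite (le_trans (ler_normB _ _))// mulr2n mulrDl mul1r lerD//.
  by rewrite (le_trans (norm_tens_at _ _ _))// norm_pure0 mul1r.
move=> v; rewrite (tens_at_pure (erefl n : 0 + n = n)%N).
rewrite (_ : _ \o _ = v) ?subrr//; apply/funext => a /=; rewrite /fam_cat.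
case: fintype.splitP => [[]//|b] /= Eb.
by congr v; apply/val_inj.
Qed.

Lemma tens_at1r n (x : E n) : tens_at n x (tone0 E) = x.
Proof.
apply/eqP; rewrite -subr_eq0; apply/eqP.
apply: (@bounded_linear_eq0 _ _ (fun x => tens_at n x (tone0 E) - x) 2) x.
- by move=> a x1 x2; rewrite tens_at_linearl scalerBr opprD addrACA.
- move=> x; rewrite (le_trans (ler_normB _ _))// mulr2n mulrDl mul1r lerD//.
  by rewrite (le_trans (norm_tens_at _ _ _))// norm_pure0 mulr1.
move=> v; rewrite (tens_at_pure (addn0 n)).
rewrite (_ : _ \o _ = v) ?subrr//; apply/funext => a /=; rewrite /fam_cat.
case: fintype.splitP => [b|[]//] /= Eb.
by congr v; apply/val_inj.
Qed.

Lemma tmulE k (a b : tseq E) n : (n <= k)%N ->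
  tmul k a b n = \sum_(i < n.+1) tens_at n (a i) (b (n - i)%N).
Proof.
move=> nk; rewrite /tmul nk; apply: eq_bigr => i _.
by rewrite (tens_atE (subnKC (leq_ord i))).
Qed.

Lemma big_ord_single (M : nmodType) N m (F : nat -> M) :
  (forall i, i != m -> F i = 0) ->
  \sum_(i < N) F i = if (m < N)%N then F m else 0.
Proof.
move=> F0; case: ltnP => [mN|Nm].
  rewrite (bigD1 (Ordinal mN))//= big1 ?addr0// => i im.
  by apply: F0; apply: contraNneq im => im; apply/eqP/val_inj.
by rewrite big1// => i _; apply: F0; rewrite neq_ltn (leq_trans (ltn_ord i) Nm).
Qed.

(** The pairs of levels added here contribute 0. *)
Lemma tmul_full N k (a b : tseq E) n : (n <= k)%N -> (n < N)%N ->
  tmul k a b n = \sum_(i < N) \sum_(j < N) tens_at n (a i) (b j).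
Proof.
move=> nk nN; rewrite tmulE// -(subnKC nN).
rewrite [RHS]big_split_ord /= [X in _ = _ + X]big1 ?addr0.
  apply: eq_bigr => i _; apply: esym.
  apply: (etrans (@big_ord_single _ _ (n - i)%N (fun j => tens_at n (a i) (b j)) _)); last first.
    by rewrite subnKC// (leq_ltn_trans (leq_subr _ _) nN).
  move=> j jn; apply: tens_at_eq0; apply: contraNneq jn => ijn.
  by rewrite -(eqn_add2l i) subnKC ?leq_ord// ijn.
move=> i _; apply: big1 => j _; apply: tens_at_eq0.
by rewrite gtn_eqF// -addnA ltnS leq_addr.
Qed.

Lemma tseqP (a b : tseq E) : (forall i, a i = b i) -> a = b.
Proof. exact: functional_extensionality_dep. Qed.

Lemma tmulA k (a b c : tseq E) : tmul k (tmul k a b) c = tmul k a (tmul k b c).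
Proof.
apply: tseqP => n; case: (leqP n k) => nk; last first.
  by rewrite /tmul leqNgt nk.
have tr (x y : tseq E) (l : nat) : (l < n.+1)%N ->
    tmul k x y l = \sum_(i < n.+1) \sum_(j < n.+1) tens_at l (x i) (y j).
  by move=> ln; apply: tmul_full => //; rewrite (leq_trans _ nk).
rewrite !tr//.
transitivity (\sum_(i < n.+1) \sum_(j < n.+1) \sum_(m < n.+1)
   tens_at n (tens_at (i + j) (a i) (b j)) (c m)); last first.
  apply: eq_bigr => i _.
  transitivity (\sum_(l < n.+1) \sum_(j < n.+1) \sum_(m < n.+1)
      tens_at n (a i) (tens_at l (b j) (c m))); last first.
    apply: eq_bigr => l _; rewrite tr// tens_at_sumr; apply: eq_bigr => j _.
    by rewrite tens_at_sumr.
  rewrite [RHS]exchange_big; apply: eq_bigr => j _.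
  rewrite [RHS]exchange_big; apply: eq_bigr => m _.
  apply: esym.
  apply: (etrans (@big_ord_single _ _ (j + m)%N
    (fun l => tens_at n (a i) (tens_at l (b j) (c m))) _)).
    by move=> l lne; rewrite (@tens_at_eq0 l) ?tens_at0r// eq_sym.
  case: ltnP => jm; rewrite tens_atA//.
  by rewrite tens_at_eq0// gtn_eqF// (leq_trans jm) ?leq_addl.
transitivity (\sum_(m < n.+1) \sum_(i < n.+1) \sum_(j < n.+1) \sum_(l < n.+1)
   tens_at n (tens_at l (a i) (b j)) (c m)).
  rewrite exchange_big; apply: eq_bigr => m _.
  transitivity (\sum_(l < n.+1) \sum_(i < n.+1) \sum_(j < n.+1)
     tens_at n (tens_at l (a i) (b j)) (c m)).
    apply: eq_bigr => l _; rewrite tr// tens_at_suml; apply: eq_bigr => i _.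
    by rewrite tens_at_suml.
  rewrite exchange_big; apply: eq_bigr => i _.
  by rewrite exchange_big.
rewrite exchange_big; apply: eq_bigr => i _.
rewrite exchange_big; apply: eq_bigr => j _.
apply: eq_bigr => m _.
apply: (etrans (@big_ord_single _ _ (i + j)%N (fun l => tens_at n (tens_at l (a i) (b j)) (c m)) _)).
  by move=> l lne; rewrite (@tens_at_eq0 l) ?tens_at0l// eq_sym.
case: ltnP => ij //.
by rewrite tens_at_eq0// gtn_eqF// (leq_trans ij) ?leq_addr.
Qed.

(** The obstruction to the additivity of level n of a multiplicative functional. *)
Definition cross_terms (n : nat) (a b : tseq E) : E n :=
  \sum_(i < n.+1 | (0 < i < n)%N) tens_at n (a i) (b (n - i)%N).

Lemma cross_terms_eq n (a b a' b' : tseq E) :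
  (forall i, (0 < i < n)%N -> a i = a' i) ->
  (forall i, (0 < i < n)%N -> b i = b' i) -> cross_terms n a b = cross_terms n a' b'.
Proof.
move=> ha hb; apply: eq_bigr => i /andP[i0 i_n]; rewrite ha ?i0// hb//.
by rewrite subn_gt0 i_n ltn_subrL i0 (leq_trans _ i_n).
Qed.

Lemma tmul0 k (a b : tseq E) : a 0%N = tone0 E -> b 0%N = tone0 E ->
  tmul k a b 0%N = tone0 E.
Proof. by move=> a0 b0; rewrite tmulE// big_ord1 a0 b0 tens_at1l. Qed.

Lemma tmul_cross_terms k n (a b : tseq E) : (0 < n <= k)%N ->
  a 0%N = tone0 E -> b 0%N = tone0 E -> tmul k a b n = a n + b n + cross_terms n a b.
Proof.
move=> /andP[n0 nk] a0 b0; rewrite tmulE// /cross_terms.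
rewrite (bigD1 ord0)//= (bigD1 ord_max) /=; last by rewrite -lt0n.
rewrite subn0 subnn a0 b0 tens_at1l tens_at1r addrA [b n + _]addrC; congr (_ + _).
apply: eq_bigl => i; rewrite -!val_eqE /= -lt0n; congr (_ && _).
by rewrite ltn_neqAle leq_ord andbT.
Qed.

(** Associativity of the product, read at level n: the terms of degree one cancel. *)
Lemma cross_terms_cocycle k n (a b c : tseq E) : (0 < n <= k)%N ->
  a 0%N = tone0 E -> b 0%N = tone0 E -> c 0%N = tone0 E ->
  cross_terms n a b + cross_terms n (tmul k a b) c = cross_terms n b c + cross_terms n a (tmul k b c).
Proof.
move=> nk a0 b0 c0.
have := congr1 (fun f : tseq E => f n) (tmulA k a b c).
rewrite !(tmul_cross_terms nk) ?tmul0// => h.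
have -> : cross_terms n a b + cross_terms n (tmul k a b) c =
  a n + b n + cross_terms n a b + c n + cross_terms n (tmul k a b) c - (a n + b n + c n) by zmod.
rewrite h; zmod.
Qed.

Lemma cross_termsD n (a b x y : tseq E) :
  cross_terms n (fun i => a i + x i) (fun i => b i + y i) =
  cross_terms n a b + cross_terms n x y + (cross_terms n a y + cross_terms n x b).
Proof.
rewrite /cross_terms -!big_split /=; apply: eq_bigr => i _.
by rewrite tens_atDl !tens_atDr; zmod.
Qed.

Lemma cross_termsB n (a b a' b' : tseq E) :
  cross_terms n a b - cross_terms n a' b' =
  cross_terms n (fun i => a i - a' i) b + cross_terms n a' (fun i => b i - b' i).
Proof.
rewrite /cross_terms -sumrB -big_split /=; apply: eq_bigr => i _.
have -> : tens_at n (a i) (b (n - i)%N) =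
    tens_at n (a i - a' i) (b (n - i)%N) + tens_at n (a' i) (b (n - i)%N).
  by rewrite -tens_atDl subrK.
have -> : tens_at n (a' i) (b (n - i)%N) =
    tens_at n (a' i) (b (n - i)%N - b' (n - i)%N) + tens_at n (a' i) (b' (n - i)%N).
  by rewrite -tens_atDr subrK.
by rewrite addrA addrK.
Qed.

Lemma norm_cross_terms n (a b : tseq E) :
  `|cross_terms n a b| <= \sum_(i < n.+1 | (0 < i < n)%N) `|a i| * `|b (n - i)%N|.
Proof.
apply: (le_trans (ler_norm_sum _ _ _)); apply: ler_sum => i _.
exact: norm_tens_at.
Qed.

End Tensors.

(** * Functions on the triangle and controls *)

Lemma prod_continuous (A : topologicalType) (I : Type) (K : I -> topologicalType)
    (f : A -> prod_topology K) :
  (forall i, continuous (fun a => f a i)) -> continuous f.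
Proof.
move=> cf a; apply/cvg_sup => i.
exact: (@continuous_comp_initial _ _ _ (fun g : forall i, K i => g i) f (cf i)).
Qed.

Section BigO.
Context (R : realType) (I : Type) (v : I -> R).

Definition bigO (W : normedModType R) (th : R) (f : I -> W) : Prop :=
  exists2 K, 0 <= K & forall i, `|f i| <= K * v i `^ th.

Lemma bigO_le (W W' : normedModType R) th C (f : I -> W) (g : I -> W') : 0 <= C ->
  (forall i, `|g i| <= C * `|f i|) -> bigO th f -> bigO th g.
Proof.
move=> C0 hg [K K0 hf]; exists (C * K) => [|i]; first exact: mulr_ge0.
by rewrite (le_trans (hg i))// -mulrA ler_wpM2l.
Qed.

Lemma bigO_ext (W : normedModType R) th (f g : I -> W) : f =1 g -> bigO th f -> bigO th g.
Proof. by move=> /funext ->. Qed.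

Lemma bigO0 (W : normedModType R) th : bigO th (fun=> 0 : W).
Proof. by exists 0 => // i; rewrite normr0 mul0r. Qed.

Lemma bigOD (W : normedModType R) th (f g : I -> W) :
  bigO th f -> bigO th g -> bigO th (fun i => f i + g i).
Proof.
move=> [K K0 hf] [L L0 hg]; exists (K + L) => [|i]; first exact: addr_ge0.
by rewrite mulrDl (le_trans (ler_normD _ _))// lerD.
Qed.

Lemma bigOZ (W : normedModType R) th (c : R) (f : I -> W) :
  bigO th f -> bigO th (fun i => c *: f i).
Proof.
by apply: (@bigO_le _ _ _ `|c|) => // i; rewrite normrZ.
Qed.

Lemma bigOB (W : normedModType R) th (f g : I -> W) :
  bigO th f -> bigO th g -> bigO th (fun i => f i - g i).
Proof.
move=> hf /(bigOZ (-1)) hg.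
by apply: bigO_ext (bigOD hf hg) => i; rewrite scaleN1r.
Qed.

Lemma bigO_sum (W : normedModType R) th (J : Type) (r : seq J) (P : pred J)
    (F : J -> I -> W) :
  (forall j, P j -> bigO th (F j)) -> bigO th (fun i => \sum_(j <- r | P j) F j i).
Proof.
move=> hF; elim: r => [|j r IH].
  by apply: bigO_ext (bigO0 W th) => i; rewrite big_nil.
have [Pj|Pj] := boolP (P j).
  by apply: bigO_ext (bigOD (hF j Pj) IH) => i; rewrite big_cons Pj.
by apply: bigO_ext IH => i; rewrite big_cons (negbTE Pj).
Qed.

(** A bounded quantity is at most a multiple of its smaller powers. *)
Lemma bigO_weaken (W : normedModType R) M th th' (f : I -> W) :
  (forall i, 0 <= v i <= M) -> 0 < th' -> th' <= th -> bigO th f -> bigO th' f.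
Proof.
move=> vM th0 thth [K K0 hf]; exists (K * M `^ (th - th')) => [|i].
  by rewrite mulr_ge0 ?powR_ge0.
have /andP[v0 vi] := vM i.
apply: (le_trans (hf i)); rewrite -mulrA ler_wpM2l//.
rewrite -[in leLHS](subrK th' th) powRD; last first.
  by rewrite subrK gt_eqF// (lt_le_trans th0).
rewrite ler_wpM2r ?powR_ge0// ge0_ler_powR ?nnegrE ?subr_ge0//.
exact: le_trans v0 vi.
Qed.

Lemma bigO_mul (W1 W2 W : normedModType R) a b (f : I -> W1) (g : I -> W2) (h : I -> W) :
  0 < a -> 0 < b -> (forall i, `|h i| <= `|f i| * `|g i|) ->
  bigO a f -> bigO b g -> bigO (a + b) h.
Proof.
move=> a0 b0 hh [K K0 hf] [L L0 hg]; exists (K * L) => [|i]; first exact: mulr_ge0.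
rewrite (le_trans (hh i))// powRD; last by rewrite gt_eqF// addr_gt0.
by rewrite mulrACA ler_pM.
Qed.

End BigO.

Lemma bigO_comp (R : realType) (I J : Type) (v : I -> R) (u : J -> R) (phi : J -> I)
    (W : normedModType R) th (f : I -> W) : 0 <= th ->
  (forall j, 0 <= v (phi j) <= u j) -> bigO v th f -> bigO u th (f \o phi).
Proof.
move=> th0 vu [K K0 hf]; exists K => // j.
have /andP[v0 vuj] := vu j.
rewrite (le_trans (hf _))// ler_wpM2l// ge0_ler_powR ?nnegrE//.
exact: le_trans v0 vuj.
Qed.

Section Triangle.
Context (R : realType) (S T : R) (hST : S <= T).

Local Notation tri := (triangle S T).

(** A continuous retraction of the plane onto the triangle.  It turns functions on
    the triangle into functions of two unconstrained real numbers. *)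
Definition retract_point (st : R * R) : R * R :=
  (Num.min (Num.max S st.1) T,
   Num.min (Num.max (Num.min (Num.max S st.1) T) st.2) T).

Lemma retract_point_in st : triangle S T (retract_point st).
Proof.
rewrite /triangle /retract_point /=; split.
- by rewrite le_min hST andbT le_max lexx.
- set s := Num.min (Num.max S _) T.
  have sT : s <= T by rewrite /s ge_min lexx orbT.
  by rewrite le_min sT andbT le_max lexx.
- by rewrite ge_min lexx orbT.
Qed.

Definition retract (st : R * R) : tri := SigSub (mem_set (retract_point_in st)).

Definition pt (s t : R) : tri := retract (s, t).

Lemma val_pt s t : S <= s -> s <= t -> t <= T -> set_val (pt s t) = (s, t).
Proof.
move=> Ss st tT; have h1 : Num.min (Num.max S s) T = s.
  by rewrite max_r// min_l// (le_trans st).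
rewrite -[LHS]/(retract_point (s, t)) /retract_point /fst /snd h1.
by rewrite max_r// min_l.
Qed.

Lemma triP (a : tri) : [/\ S <= (set_val a).1, (set_val a).1 <= (set_val a).2 & (set_val a).2 <= T].
Proof. exact: set_valP a. Qed.

Lemma pt_val (a : tri) : pt (set_val a).1 (set_val a).2 = a.
Proof.
by apply/val_inj; have [h1 h2 h3] := triP a; rewrite [LHS]val_pt// -surjective_pairing.
Qed.

Lemma retract_continuous : continuous retract.
Proof.
apply: (@continuous_comp_initial _ _ _ (set_val : tri -> R * R) retract) => st.
have c1 : {for st, continuous (fun st : R * R => Num.min (Num.max S st.1) T : R^o)}.
  apply: continuous_min; last exact: cvg_cst.
  by apply: continuous_max; [exact: cvg_cst|exact: cvg_fst].
suff c2 : {for st, continuous (fun st : R * R =>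
    Num.min (Num.max (Num.min (Num.max S st.1) T) st.2) T : R^o)}.
  exact: (cvg_pair c1 c2).
apply: (@continuous_min _ _
  (fun st : R * R => Num.max (Num.min (Num.max S st.1) T) st.2 : R^o) (fun=> T)); last exact: cvg_cst.
by apply: continuous_max; [exact: c1|exact: cvg_snd].
Qed.

Lemma splits_pt s u t : S <= s -> s <= u -> u <= t -> t <= T ->
  splits (pt s u) (pt u t) (pt s t).
Proof.
move=> h1 h2 h3 h4; rewrite /splits.
by rewrite !val_pt//; lra.
Qed.

Lemma splits_ptP a b c : splits a b c -> exists s u t,
  [/\ S <= s, s <= u, u <= t & t <= T] /\ [/\ a = pt s u, b = pt u t & c = pt s t].
Proof.
case=> h1 h2 h3; have [a1 a2 a3] := triP a; have [b1 b2 b3] := triP b.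
exists (set_val a).1, (set_val a).2, (set_val b).2; split; first by split=> //; rewrite h2.
by split; [rewrite pt_val|rewrite h2 pt_val|rewrite h1 h3 pt_val].
Qed.

Lemma controlD (w1 w2 : tri -> R) : is_control w1 -> is_control w2 ->
  is_control (fun a => w1 a + w2 a).
Proof.
move=> [c1 p1 d1 s1] [c2 p2 d2 s2]; split.
- by move=> a; exact: (@cvgD _ R^o _ _ _ w1 w2 _ _ (c1 a) (c2 a)).
- by move=> a; rewrite addr_ge0.
- by move=> a aa; rewrite d1// d2// addr0.
- by move=> a b c abc; rewrite addrACA lerD ?s1 ?s2.
Qed.

Lemma control0 : is_control (fun _ : tri => 0 : R).
Proof.
split; [exact: cst_continuous|by []|by []|].
by move=> *; rewrite addr0.
Qed.

Section Control.
Context (w : tri -> R) (cw : is_control w).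

Lemma control_ge0 a : 0 <= w a. Proof. by case: cw. Qed.

Lemma control_split_le a b c : splits a b c -> w a <= w c /\ w b <= w c.
Proof.
move=> abc; have [_ w0 _ ws] := cw; have := ws _ _ _ abc.
by have := w0 a; have := w0 b; lra.
Qed.

Lemma control_bound a : 0 <= w a <= w (pt S T).
Proof.
rewrite control_ge0 /=; have [h1 h2 h3] := triP a.
have [_ wst] := control_split_le (splits_pt (lexx S) h1 h2 h3).
have [wSt _] := control_split_le (splits_pt (lexx S) (le_trans h1 h2) h3 (lexx T)).
by rewrite pt_val in wst; exact: le_trans wst wSt.
Qed.

Let wt s t := w (pt s t).

Lemma control_pt_ge0 s t : S <= s -> s <= t -> t <= T -> 0 <= wt s t.
Proof. by move=> *; exact: control_ge0. Qed.

Lemma control_pt_diag s : S <= s -> s <= T -> wt s s = 0.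
Proof. by move=> Ss sT; have [_ _ wd _] := cw; apply: wd; rewrite val_pt. Qed.

Lemma control_pt_super s u t : S <= s -> s <= u -> u <= t -> t <= T ->
  wt s u + wt u t <= wt s t.
Proof.
by move=> *; have [_ _ _ ws] := cw; apply: ws; exact: splits_pt.
Qed.

(** The intermediate value theorem gives u with w(s,u) = w(s,t)/2, and w(u,t) is
    then bounded by superadditivity. *)
Lemma control_midpoint s t : S <= s -> s <= t -> t <= T ->
  exists u, [/\ s <= u, u <= t, wt s u <= wt s t / 2 & wt u t <= wt s t / 2].
Proof.
move=> Ss st tT.
have wst := control_pt_ge0 Ss st tT.
have wss := control_pt_diag Ss (le_trans st tT).
have cf : continuous (wt s : R -> R).
  move=> u; have [cw' _ _ _] := cw.
  apply: (@continuous_comp _ _ _ (fun u => pt s u) w); last exact: cw'.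
  apply: (@continuous_comp _ _ _ (fun u => (s, u)) retract); last exact: retract_continuous.
  have c1 : {for u, continuous (fun _ : R => s)} by exact: cvg_cst.
  have c2 : {for u, continuous (fun u : R => u)} by exact: cvg_id.
  exact: (cvg_pair c1 c2).
have [|u] := @IVT R (wt s) s t (wt s t / 2) st (continuous_subspaceT cf).
  by rewrite wss min_l// max_r//; lra.
rewrite in_itv /= => /andP[su ut] Eu.
exists u; split=> //; first by rewrite Eu.
have := control_pt_super Ss su ut tT; lra.
Qed.

(** This is the source of all the uniqueness statements below. *)
Lemma additive_bigO_eq0 (W : completeNormedModType R) th (D : tri -> W) : 1 < th ->
  (forall a b c, splits a b c -> D a + D b = D c) -> bigO w th D ->
  forall a, D a = 0.
Proof.
move=> th1 Dadd [K K0 hD] a; have [h1 h2 h3] := triP a.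
rewrite -(pt_val a); move: (set_val a).1 (set_val a).2 h1 h2 h3.
apply: (small_additive_eq0 (w := wt) (th := th) th1) K0 _ _.
- exact: control_pt_ge0.
- exact: control_pt_diag.
- exact: control_pt_super.
- exact: control_midpoint.
- by move=> *; apply: Dadd; exact: splits_pt.
- by move=> *; exact: hD.
Qed.

End Control.

(** Indexing by the cuts s <= u <= t of an interval allows [bigO] to express bounds
    on three-point defects in terms of the control of the whole interval. *)
Record cut := Cut { cutl : tri; cutr : tri; cutw : tri; cutP : splits cutl cutr cutw }.

(** With A(s,t) = F(S,s,t) the cocycle identity says that F is the defect
    A(s,u) + A(u,t) - A(s,t), so that A is almost additive.  If B is additive and
    close to A, then h = B - A has the required defect. *)
Lemma cocycle_sewing (W : completeNormedModType R) (w : tri -> R) th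
    (F : tri -> tri -> tri -> W) : is_control w -> 1 < th ->
  (forall s u v t, S <= s -> s <= u -> u <= v -> v <= t -> t <= T ->
    F (pt s u) (pt u v) (pt s v) + F (pt s v) (pt v t) (pt s t)
    = F (pt u v) (pt v t) (pt u t) + F (pt s u) (pt u t) (pt s t)) ->
  bigO (w \o cutw) th (fun x => F (cutl x) (cutr x) (cutw x)) ->
  exists2 h : tri -> W, bigO w th h &
    forall a b c, splits a b c -> h c = h a + h b + F a b c.
Proof.
move=> cw th1 cocF [K K0 hF].
pose A s t := F (pt S s) (pt s t) (pt S t).
have AE s u t : S <= s -> s <= u -> u <= t -> t <= T ->
    A s u + A u t - A s t = F (pt s u) (pt u t) (pt s t).
  by move=> h1 h2 h3 h4; rewrite /A (cocF S s u t)// addrK.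
have hA s u t : S <= s -> s <= u -> u <= t -> t <= T ->
    `|A s u + A u t - A s t| <= K * w (pt s t) `^ th.
  move=> h1 h2 h3 h4; rewrite AE//.
  exact: (hF (Cut (splits_pt h1 h2 h3 h4))).
have [B [addB [C C0 hB]]] := additive_sewing th1 (control_pt_ge0 cw) (control_pt_diag cw)
  (control_pt_super cw) (control_midpoint cw) K0 hA.
exists (fun a => B (set_val a).1 (set_val a).2 - A (set_val a).1 (set_val a).2).
  exists C => // a; have [h1 h2 h3] := triP a.
  by have := hB _ _ h1 h2 h3; rewrite pt_val.
move=> a b c /splits_ptP[s [u [t [[h1 h2 h3 h4] [-> -> ->]]]]].
have Su := le_trans h1 h2; have st := le_trans h2 h3; have uT := le_trans h3 h4.
rewrite !val_pt//=.
rewrite -(addB s u t)// -AE//; zmod.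
Qed.

End Triangle.

Arguments cutl {R S T} _.
Arguments cutr {R S T} _.
Arguments cutw {R S T} _.

(** * Multiplicative functionals and their continuity *)

Section MultiplicativeFunctionals.
Context (R : realType) (V : completeNormedModType R) (E : tensor_powers V).
Context (S T : R) (hST : S <= T).

Local Notation tri := (triangle S T).
Local Notation tmap := (tmap E S T).
Local Notation pt := (pt hST).

(** Multiplicativity in the sense of Chen's relation, without continuity: the
    functionals constructed below satisfy it first, and their continuity is then
    deduced from their variation. *)
Definition chen (k : nat) (X : tmap) : Prop :=
  [/\ forall a, tensor_alg k (X a),
      forall a, X a 0%N = tone0 E
    & forall a b c, splits a b c -> tmul k (X a) (X b) = X c].

(** The recursive structure of a multiplicative functional: at each level it is
    additive up to a term that only depends on the lower levels. *)
Lemma chen_level k X a b c i : chen k X -> splits a b c -> (0 < i <= k)%N ->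
  X c i = X a i + X b i + cross_terms i (X a) (X b).
Proof.
move=> [_ X0 Xm] abc ik; rewrite -(Xm _ _ _ abc).
by apply: tmul_cross_terms ik _ _; rewrite ?X0.
Qed.

Lemma chen_of_levels k (X : tmap) :
  (forall a, tensor_alg k (X a)) -> (forall a, X a 0%N = tone0 E) ->
  (forall a b c i, splits a b c -> (0 < i <= k)%N ->
    X c i = X a i + X b i + cross_terms i (X a) (X b)) -> chen k X.
Proof.
move=> Xk X0 Xi; split=> // a b c abc; apply: tseqP => i.
have [ik|ki] := leqP i k; last by rewrite /tmul leqNgt ki /= Xk.
have [->|i0] := posnP i; first by rewrite tmul0 ?X0.
by rewrite (@tmul_cross_terms _ _ _ k) ?X0 ?i0// (Xi _ _ _ _ abc) ?i0.
Qed.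

Section Continuity.
Context (w : tri -> R) (cw : is_control w).

Lemma bigO_uniform k (X : tmap) (e : nat -> R) :
  (forall i, (0 < i <= k)%N -> bigO w (e i) (fun a => X a i)) ->
  exists2 K, 0 <= K & forall i a, (0 < i <= k)%N -> `|X a i| <= K * w a `^ e i.
Proof.
elim: k => [_|k IH hX]; first by exists 0 => // i a; case: i.
have [|K K0 hK] := IH; first by move=> i /andP[i0 ik]; apply: hX; rewrite i0 leqW.
have [|L L0 hL] := hX k.+1; first by rewrite leqnn.
exists (K + L) => [|i a]; first exact: addr_ge0.
move=> /andP[i0]; rewrite leq_eqVlt => /orP[/eqP->|ik].
  by rewrite (le_trans (hL a))// ler_wpM2r ?powR_ge0// lerDr.
by rewrite (le_trans (hK i a _)) ?i0// ler_wpM2r ?powR_ge0// lerDl.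
Qed.

Lemma powR_control_small (phi : tri -> tri) e a0 : 0 < e ->
  {for a0, continuous phi} -> w (phi a0) = 0 ->
  (fun a => w (phi a) `^ e : R^o) @ a0 --> (0 : R^o).
Proof.
move=> e0 cphi w0; have [cw' wp _ _] := cw.
have FF : Filter (nbhs a0) := nbhs_filter a0.
apply/cvgr0Pnorm_lt => x x0.
have cwp : (fun a => w (phi a) : R^o) @ a0 --> (0 : R^o).
  by rewrite -[X in _ --> X]w0; exact: (continuous_comp cphi (cw' _)).
have y0 : 0 < x `^ e^-1 by exact: powR_gt0.
move/cvgr0Pnorm_lt : cwp => /(_ _ y0); apply: filterS => a.
rewrite !ger0_norm ?powR_ge0// => h.
rewrite -[ltRHS](_ : (x `^ e^-1) `^ e = x).
  by rewrite gt0_ltr_powR// nnegrE ?powR_ge0.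
by rewrite -powRrM mulVf ?gt_eqF// powRr1// ltW.
Qed.

Lemma pt_continuous (f g : tri -> R) : continuous (f : tri -> R^o) -> continuous (g : tri -> R^o) ->
  continuous (fun a => pt (f a) (g a)).
Proof.
move=> cf cg a.
apply: (@continuous_comp _ _ _ (fun a => (f a, g a)) (retract hST)).
  exact: (cvg_pair (cf a) (cg a)).
exact: retract_continuous.
Qed.

(** Two nearby intervals are both contained in their hull, which is obtained from
    each of them by multiplying on the left and on the right by increments over
    intervals that shrink to a point.  These increments tend to the unit because
    a control is continuous and vanishes on the diagonal. *)
Lemma chen_continuous k e (X : tmap) : chen k X -> 0 < e ->
  (forall i, (0 < i <= k)%N -> bigO w e (fun a => X a i)) -> continuous X.
Proof.
move=> Xm e0 hX; apply: prod_continuous => i a0.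
have [X0 Xk _] := (let: And3 a b c := Xm in And3 b a c).
(* Level 0 and the levels above k are constant. *)
have cst_case : (forall a, X a i = X a0 i) -> (fun a => X a i) @ a0 --> X a0 i.
  move=> h; have -> : (fun a => X a i) = (fun=> X a0 i) by apply/funext.
  exact: cst_continuous.
have [i0|i0] := posnP i.
  by apply: cst_case => a; rewrite i0 !X0.
have [ik|ki] := leqP i k; last by apply: cst_case => a; rewrite !Xk.
have [K K0 hK] := bigO_uniform (e := fun=> e) hX.
pose B := K * w (pt S T) `^ e.
have XB a j : (0 < j <= k)%N -> `|X a j| <= B.
  move=> jk; rewrite (le_trans (hK _ _ jk))// ler_wpM2l//.
  have /andP[w0 wM] := control_bound hST cw a.
  by rewrite ge0_ler_powR ?nnegrE ?(ltW e0)// (le_trans w0).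
pose N : R := \sum_(j < i.+1 | (0 < j < i)%N) B.
have N0 : 0 <= N by apply: sumr_ge0 => j _; rewrite mulr_ge0 ?powR_ge0.
have lvl j : (0 < j < i)%N -> ((0 < j <= k) && (0 < i - j <= k))%N.
  move=> /andP[j0 ji]; rewrite j0 (leq_trans (ltnW ji))//= subn_gt0 ji.
  exact: leq_trans (leq_subr _ _) ik.
(* Moving an end point of an interval changes level i by one increment of
   level i and by the cross terms, in which the other factor is at most B. *)
pose G := K * (1 + N).
have near_r a b c : splits a b c -> `|X c i - X b i| <= G * w a `^ e.
  move=> abc; rewrite (chen_level Xm abc) ?i0//.
  have -> : X a i + X b i + cross_terms i (X a) (X b) - X b i = X a i + cross_terms i (X a) (X b) by zmod.
  rewrite (le_trans (ler_normD _ _))// /G mulrAC mulrDr mulr1 lerD ?hK ?i0//.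
  rewrite (le_trans (norm_cross_terms _ _ _))// /N mulr_sumr ler_sum// => j /lvl/andP[j1 j2].
  by rewrite ler_pM// ?hK// XB.
have near_l a b c : splits a b c -> `|X c i - X a i| <= G * w b `^ e.
  move=> abc; rewrite (chen_level Xm abc) ?i0//.
  have -> : X a i + X b i + cross_terms i (X a) (X b) - X a i = X b i + cross_terms i (X a) (X b) by zmod.
  rewrite (le_trans (ler_normD _ _))// /G mulrAC mulrDr mulr1 lerD ?hK ?i0//.
  rewrite (le_trans (norm_cross_terms _ _ _))// /N mulr_sumr ler_sum// => j /lvl/andP[j1 j2].
  by rewrite mulrC ler_pM// ?hK// XB.
pose s0 := (set_val a0).1; pose t0 := (set_val a0).2.
have [Ss0 st0 tT0] := triP a0; rewrite -/s0 -/t0 in Ss0 st0 tT0.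
pose s (a : tri) := (set_val a).1; pose t (a : tri) := (set_val a).2.
pose s' a := Num.min (s a) s0; pose t' a := Num.max (t a) t0.
have cs : continuous (s : tri -> R^o).
  move=> a; apply: (@continuous_comp _ _ _ (set_val : tri -> R * R) fst); last exact: cvg_fst.
  exact: initial_continuous.
have ct : continuous (t : tri -> R^o).
  move=> a; apply: (@continuous_comp _ _ _ (set_val : tri -> R * R) snd); last exact: cvg_snd.
  exact: initial_continuous.
have cs' : continuous (s' : tri -> R^o).
  by move=> a; apply: continuous_min; [exact: cs|exact: cst_continuous].
have ct' : continuous (t' : tri -> R^o).
  by move=> a; apply: continuous_max; [exact: ct|exact: cst_continuous].
have ck (r : R) : continuous (fun _ : tri => r : R^o) by exact: cst_continuous.
(* The hull of a0 and a is [s' a, t' a]; the four terms measure the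
   pieces by which the hull exceeds a and a0. *)
pose psi a : R^o := G * (w (pt (s' a) (s a)) `^ e + w (pt (t a) (t' a)) `^ e +
   (w (pt (s' a) s0) `^ e + w (pt t0 (t' a)) `^ e)).
have hpsi a : `|X a0 i - X a i| <= psi a.
  have [Ss st tT] := triP a; rewrite -/(s a) -/(t a) in Ss st tT.
  have h1 : S <= s' a by rewrite le_min Ss.
  have h2 : s' a <= s a by rewrite ge_min lexx.
  have h3 : s' a <= s0 by rewrite ge_min lexx orbT.
  have h4 : t a <= t' a by rewrite le_max lexx.
  have h5 : t0 <= t' a by rewrite le_max lexx orbT.
  have h6 : t' a <= T by rewrite ge_max tT.
  have b1 := near_r _ _ _ (splits_pt hST h1 h2 st tT).
  have b2 := near_l _ _ _ (splits_pt hST h1 (le_trans h2 st) h4 h6).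
  have b3 := near_r _ _ _ (splits_pt hST h1 h3 st0 tT0).
  have b4 := near_l _ _ _ (splits_pt hST h1 (le_trans h3 st0) h5 h6).
  rewrite pt_val in b1; rewrite pt_val in b3.
  set m := pt (s' a) (t' a) in b2 b4; set n := pt (s' a) (t a) in b1 b2.
  set n0 := pt (s' a) t0 in b3 b4.
  have -> : X a0 i - X a i = (X n i - X a i) + (X m i - X n i) -
     ((X n0 i - X a0 i) + (X m i - X n0 i)) by zmod.
  rewrite (le_trans (ler_normB _ _))// (le_trans (lerD (ler_normD _ _) (ler_normD _ _)))//.
  by rewrite (le_trans (lerD (lerD b1 b2) (lerD b3 b4)))// -!mulrDr.
have psi0 : psi @ a0 --> (0 : R^o).
  have Z (phi : tri -> tri) : continuous phi -> w (phi a0) = 0 ->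
     (fun a => w (phi a) `^ e : R^o) @ a0 --> (0 : R^o).
    by move=> cphi; exact: (powR_control_small e0 (cphi a0)).
  have z1 := Z _ (pt_continuous cs' cs).
  have z2 := Z _ (pt_continuous ct ct').
  have z3 := Z _ (pt_continuous cs' (ck s0)).
  have z4 := Z _ (pt_continuous (ck t0) ct').
  have sd : s' a0 = s0 by rewrite /s' /s -/s0 minxx.
  have td : t' a0 = t0 by rewrite /t' /t -/t0 maxxx.
  have sT0 := le_trans st0 tT0; have St0 := le_trans Ss0 st0.
  have ds := control_pt_diag hST cw Ss0 sT0.
  have dt := control_pt_diag hST cw St0 tT0.
  rewrite sd -/(s a0) in z1 z3; rewrite td in z2 z4.
  have FF : Filter (nbhs a0) := nbhs_filter a0.
  have cD f g (x y : R) := @cvgD _ R^o _ (nbhs a0) FF f g x y.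
  have := cD _ _ _ _ (cD _ _ _ _ (z1 ds) (z2 dt)) (cD _ _ _ _ (z3 ds) (z4 dt)).
  move=> /(@cvgM _ _ (nbhs a0) FF _ _ _ _ (cvg_cst G)).
  by rewrite !addr0 mulr0.
have FF : Filter (nbhs a0) := nbhs_filter a0.
apply/cvgrPdist_lt => x x0.
move/cvgr0Pnorm_lt : psi0 => /(_ _ x0); apply: filterS => a.
by apply: le_lt_trans; rewrite (le_trans (hpsi a))// ler_norm.
Qed.

End Continuity.

End MultiplicativeFunctionals.

(** * Finite variation, uniqueness and gluing of levels *)

Section FiniteVariation.
Context (R : realType) (V : completeNormedModType R) (E : tensor_powers V).
Context (S T : R) (hST : S <= T).

Local Notation tri := (triangle S T).
Local Notation tmap := (tmap E S T).
Local Notation pt := (pt hST).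

Definition levels_bigO (k : nat) (w : tri -> R) (e : nat -> R) (X : tmap) : Prop :=
  forall i, (0 < i <= k)%N -> bigO w (e i) (fun a => X a i).

Lemma bigO_of_le (I : Type) (v : I -> R) (W : normedModType R) (th K : R) (f : I -> W) :
  (forall i, `|f i| <= K * v i `^ th) -> bigO v th f.
Proof.
move=> hf; exists `|K| => // i.
by rewrite (le_trans (hf i))// ler_wpM2r ?powR_ge0// ler_norm.
Qed.

Lemma finite_variation_bigO k p w K (X : tmap) : 1 <= p ->
  finite_variation k p w K X -> levels_bigO k w (fun i => i%:R / p) X.
Proof.
move=> p1 fX i ik; apply: (@bigO_of_le _ _ _ _ (K / (beta p * rfact (i%:R / p)))) => a.
by rewrite (le_trans (fX i a ik))// mulrAC.
Qed.

Lemma bigO_finite_variation k p w (X : tmap) : 1 <= p ->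
  levels_bigO k w (fun i => i%:R / p) X ->
  exists2 K, 0 <= K & finite_variation k p w K X.
Proof.
move=> p1 /bigO_uniform[K K0 hK].
pose c i : R := beta p * rfact (i%:R / p).
have c0 i : 0 < c i.
  by rewrite mulr_gt0 ?beta_gt0// rfact_gt0// divr_ge0// (le_trans _ p1).
exists (K * \sum_(i < k.+1) c i) => [|i a ik].
  by rewrite mulr_ge0// sumr_ge0// => i _; exact: ltW.
rewrite -/(c i) ler_pdivlMr// (le_trans (ler_wpM2r (ltW (c0 i)) (hK _ _ ik)))//.
rewrite -!mulrA ler_wpM2l// mulrC ler_wpM2r ?powR_ge0//.
have ik' : (i < k.+1)%N by case/andP: ik.
rewrite (bigD1 (Ordinal ik'))//= lerDl sumr_ge0// => j _; exact: ltW.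
Qed.

Lemma finite_variation_le k p w K L (X : tmap) : 1 <= p -> K <= L ->
  finite_variation k p w K X -> finite_variation k p w L X.
Proof.
move=> p1 KL fX i a ik; rewrite (le_trans (fX i a ik))//.
have b0 := beta_gt0 p1.
have r0 : 0 < rfact (i%:R / p) by rewrite rfact_gt0// divr_ge0// (le_trans _ p1).
have c0 : 0 <= (beta p * rfact (i%:R / p))^-1 by rewrite invr_ge0 mulr_ge0 ?ltW.
exact: ler_wpM2r c0 _ _ (ler_wpM2r (powR_ge0 _ _) KL).
Qed.

Lemma levels_bigO_weaken k w (e e' : nat -> R) (X : tmap) : is_control w ->
  (forall i, (0 < i <= k)%N -> 0 < e' i <= e i) ->
  levels_bigO k w e X -> levels_bigO k w e' X.
Proof.
move=> cw he hX i ik; have /andP[e0 ee] := he i ik.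
exact: bigO_weaken (control_bound hST cw) e0 ee (hX i ik).
Qed.

Lemma OmegaP k q (X : tmap) : 1 <= q -> Omega k q X <->
  chen k X /\ exists2 w, is_control w & levels_bigO k w (fun i => i%:R / q) X.
Proof.
move=> q1; have q0 : 0 < q by rewrite (lt_le_trans _ q1).
split=> [[[Xk _ X0 Xm] [w [K [cw fX]]]]|[Xm [w cw hX]]].
  by split=> //; exists w => //; exact: finite_variation_bigO fX.
have [Xk X0 Xs] := Xm; split.
  split=> //; apply: (chen_continuous hST cw (e := q^-1) Xm); first by rewrite invr_gt0.
  apply: levels_bigO_weaken cw _ hX => i /andP[i0 _].
  by rewrite invr_gt0 q0 -[leLHS]mul1r ler_wpM2r ?invr_ge0 ?(ltW q0)// ler1n.
by have [K K0 fX] := bigO_finite_variation q1 hX; exists w, K.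
Qed.

Lemma bigO_control_le (w w' : tri -> R) (W : normedModType R) th (f : tri -> W) :
  is_control w -> 0 <= th -> (forall a, w a <= w' a) -> bigO w th f -> bigO w' th f.
Proof.
move=> cw th0 ww'; apply: (@bigO_comp _ _ _ w w' id) => // a /=.
by rewrite (control_ge0 cw) ww'.
Qed.

(** Once the levels below i agree, the difference at level i is additive and
    therefore vanishes. *)
Lemma chen_unique k th w (X Y : tmap) : is_control w -> 1 < th ->
  chen k X -> chen k Y ->
  (forall i, (0 < i <= k)%N -> bigO w th (fun a => X a i - Y a i)) -> X = Y.
Proof.
move=> cw th1 Xm Ym hXY.
have [Xk X0 _] := Xm; have [Yk Y0 _] := Ym.
suff H i : forall a, X a i = Y a i by apply/funext => a; apply: tseqP.
have [n] := ubnP i; elim: n i => // n IH i /ltnSE i_n a.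
have [->|i0] := posnP i; first by rewrite X0 Y0.
have [ik|ki] := leqP i k; last by rewrite Xk// Yk.
have ik' : (0 < i <= k)%N by rewrite i0.
apply/eqP; rewrite -subr_eq0; apply/eqP; move: a.
apply: (additive_bigO_eq0 hST cw th1) (hXY i ik') => a b c abc.
rewrite (chen_level Xm abc ik') (chen_level Ym abc ik').
rewrite (@cross_terms_eq _ _ _ _ (X a) (X b) (Y a) (Y b)); first zmod.
  by move=> j /andP[_ ji]; apply: IH; exact: leq_trans ji i_n.
by move=> j /andP[_ ji]; apply: IH; exact: leq_trans ji i_n.
Qed.

(** The graded sequence with x at level n and 0 elsewhere: multiplying by the unit
    of level 0 moves x from level n to level i if n = i and gives 0 otherwise. *)
Definition single (n : nat) (x : E n) : tseq E := fun i => tens_at i x (tone0 E).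

Lemma single_id n (x : E n) : single x n = x.
Proof. exact: tens_at1r. Qed.

Lemma single_neq n (x : E n) i : i != n -> single x i = 0.
Proof. by move=> ne; rewrite /single tens_at_eq0// addn0 eq_sym. Qed.

Lemma chen_truncate j k (X : tmap) : (j <= k)%N -> chen k X -> chen j (truncate j X).
Proof.
move=> jk Xm; have [Xk X0 _] := Xm; apply: chen_of_levels => [a i|a|a b c i abc /andP[i0 ij]].
- by move=> ji; rewrite /truncate leqNgt ji.
- by rewrite /truncate X0.
- rewrite /truncate ij (chen_level Xm abc) ?i0 ?(leq_trans ij)//.
  by congr (_ + _); apply: cross_terms_eq => l /andP[l0 li]; rewrite (leq_trans (ltnW li)).
Qed.

Lemma chen_tone : chen 0 (fun _ : tri => tone E).
Proof. by apply: chen_of_levels => // [a [|i]//|a b c [|i]]. Qed.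

Lemma chen_extend j (Z : tmap) (h : tri -> E j.+1) : chen j Z ->
  (forall a b c, splits a b c -> h c = h a + h b + cross_terms j.+1 (Z a) (Z b)) ->
  chen j.+1 (tmap_add Z (fun a => single (h a))).
Proof.
move=> Zm hh; have [Zj Z0 _] := Zm.
have lo a i : (i <= j)%N -> tmap_add Z (fun a => single (h a)) a i = Z a i.
  by move=> ij; rewrite /tmap_add single_neq ?addr0// ltn_eqF.
have top a : tmap_add Z (fun a => single (h a)) a j.+1 = h a.
  by rewrite /tmap_add single_id Zj ?add0r.
apply: chen_of_levels => [a i ij|a|a b c i abc /andP[i0]].
- by rewrite /tmap_add Zj ?(ltnW ij)// single_neq ?addr0// gtn_eqF.
- by rewrite lo.
- have inn n : (n <= j.+1)%N ->
     cross_terms n (tmap_add Z (fun a => single (h a)) a) (tmap_add Z (fun a => single (h a)) b)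
     = cross_terms n (Z a) (Z b).
    by move=> nj; apply: cross_terms_eq => l /andP[_ ln]; rewrite lo// -ltnS (leq_trans ln).
  rewrite leq_eqVlt => /orP[/eqP->|]; first by rewrite !top inn// (hh _ _ _ abc).
  by rewrite ltnS => ij; rewrite !lo// inn ?leqW// (chen_level Zm abc)// i0.
Qed.

(** The top level never enters into [cross_terms], so that adding an additive
    function there preserves Chen's relation. *)
Lemma chen_add_top j (Y I : tmap) : chen j.+1 Y ->
  (forall a b c, splits a b c -> I a j.+1 + I b j.+1 = I c j.+1) ->
  chen j.+1 (tmap_add Y (only_level j.+1 I)).
Proof.
move=> Ym Iadd; have [Yj Y0 _] := Ym.
have lo a i : (i <= j)%N -> tmap_add Y (only_level j.+1 I) a i = Y a i.
  by move=> ij; rewrite /tmap_add /only_level ltn_eqF ?addr0.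
apply: chen_of_levels => [a i ij|a|a b c i abc /andP[i0]].
- by rewrite /tmap_add /only_level Yj// gtn_eqF// addr0.
- by rewrite lo.
- have inn n : (n <= j.+1)%N ->
     cross_terms n (tmap_add Y (only_level j.+1 I) a) (tmap_add Y (only_level j.+1 I) b)
     = cross_terms n (Y a) (Y b).
    by move=> nj; apply: cross_terms_eq => l /andP[_ ln]; rewrite lo// -ltnS (leq_trans ln).
  rewrite leq_eqVlt => /orP[/eqP->|]; last first.
    by rewrite ltnS => ij; rewrite !lo// inn ?leqW// (chen_level Ym abc)// i0 leqW.
  rewrite inn// /tmap_add /only_level eqxx -(Iadd _ _ _ abc) (chen_level Ym abc) ?leqnn//.
  by zmod.
Qed.

(** Orders add up under tensor products; th is any common lower bound. *)
Lemma bigO_cross_terms n (w : tri -> R) (e1 e2 : nat -> R) th (X Y : tmap) : is_control w ->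
  0 < th ->
  (forall i, (0 < i < n)%N -> [/\ 0 < e1 i, bigO w (e1 i) (fun a => X a i),
     0 < e2 (n - i)%N, bigO w (e2 (n - i)%N) (fun a => Y a (n - i)%N)
     & th <= e1 i + e2 (n - i)%N]) ->
  bigO (w \o cutw) th (fun x : cut S T => cross_terms n (X (cutl x)) (Y (cutr x))).
Proof.
move=> cw th0 hXY; apply: bigO_sum => i /hXY[e10 hX e20 hY hth].
apply: (bigO_weaken (th := e1 i + e2 (n - i)%N) (fun x => control_bound hST cw (cutw x))) => //.
apply: (@bigO_mul _ _ _ _ _ _ _ _ (fun x : cut S T => X (cutl x) i)
  (fun x : cut S T => Y (cutr x) (n - i)%N)) => //.
- by move=> x; exact: norm_tens_at.
- apply: (bigO_comp (phi := cutl) (ltW e10) _ hX) => x.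
  by rewrite (control_ge0 cw) (control_split_le cw (cutP x)).1.
- apply: (bigO_comp (phi := cutr) (ltW e20) _ hY) => x.
  by rewrite (control_ge0 cw) (control_split_le cw (cutP x)).2.
Qed.

End FiniteVariation.

(** * The extension of a multiplicative functional *)

Section Extension.
Context (R : realType) (V : completeNormedModType R) (E : tensor_powers V).
Context (S T : R) (hST : S <= T).

Local Notation tri := (triangle S T).
Local Notation tmap := (tmap E S T).
Local Notation pt := (pt hST).

(** Two functionals come with controls and exponents of their own.  The sum of the
    controls and the smaller exponent serve both. *)
Lemma common_bigO (W : normedModType R) (w1 w2 : tri -> R) th1 th2 :
  is_control w1 -> is_control w2 -> 0 < th1 -> 0 < th2 ->
  (forall f : tri -> W, bigO w1 th1 f -> bigO (fun a => w1 a + w2 a) (Num.min th1 th2) f) /\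
  (forall f : tri -> W, bigO w2 th2 f -> bigO (fun a => w1 a + w2 a) (Num.min th1 th2) f).
Proof.
move=> c1 c2 t1 t2; have c12 := controlD c1 c2.
have m0 : 0 < Num.min th1 th2 by rewrite lt_min t1.
split=> f hf.
  apply: (bigO_weaken (th := th1) (control_bound hST c12)) => //; first by rewrite ge_min lexx.
  by apply: bigO_control_le hf => // [|a]; rewrite ?(ltW t1)// lerDl (control_ge0 c2).
apply: (bigO_weaken (th := th2) (control_bound hST c12)) => //; first by rewrite ge_min lexx orbT.
by apply: bigO_control_le hf => // [|a]; rewrite ?(ltW t2)// lerDr (control_ge0 c1).
Qed.

Lemma is_extension_unique j (Z Y1 Y2 : tmap) :
  is_extension j Z Y1 -> is_extension j Z Y2 -> Y1 = Y2.
Proof.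
move=> [q1 [q11 q1j _ /(OmegaP hST _ _ q11)[m1 [w1 c1 h1]] a1]].
move=> [q2 [q21 q2j _ /(OmegaP hST _ _ q21)[m2 [w2 c2 h2]] a2]].
have q10 : 0 < q1 by rewrite (lt_le_trans _ q11).
have q20 : 0 < q2 by rewrite (lt_le_trans _ q21).
have t1 : 1 < j.+1%:R / q1 by rewrite ltr_pdivlMr// mul1r.
have t2 : 1 < j.+1%:R / q2 by rewrite ltr_pdivlMr// mul1r.
have [H1 H2] := common_bigO (E j.+1) c1 c2 (lt_trans ltr01 t1) (lt_trans ltr01 t2).
apply: (chen_unique hST (controlD c1 c2) _ m1 m2 (th := Num.min (j.+1%:R / q1) (j.+1%:R / q2))).
  by rewrite lt_min t1.
move=> i /andP[i0]; rewrite leq_eqVlt => /orP[/eqP->|].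
  by apply: bigOB; [apply: H1; apply: h1|apply: H2; apply: h2]; rewrite leqnn.
rewrite ltnS => ij; apply: bigO_ext (bigO0 _ _ _) => a.
by rewrite a1// a2// subrr.
Qed.

Lemma chen_cocycle j (Z : tmap) s u v t : chen j Z ->
  S <= s -> s <= u -> u <= v -> v <= t -> t <= T ->
  cross_terms j.+1 (Z (pt s u)) (Z (pt u v)) + cross_terms j.+1 (Z (pt s v)) (Z (pt v t))
  = cross_terms j.+1 (Z (pt u v)) (Z (pt v t)) + cross_terms j.+1 (Z (pt s u)) (Z (pt u t)).
Proof.
move=> Zm h1 h2 h3 h4 h5; have [_ Z0 _] := Zm.
have := @cross_terms_cocycle _ _ _ j.+1 j.+1 (Z (pt s u)) (Z (pt u v)) (Z (pt v t)).
rewrite leqnn !Z0 => /(_ isT erefl erefl erefl).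
have sub a b c : splits a b c -> forall i, (0 < i < j.+1)%N ->
    tmul j.+1 (Z a) (Z b) i = Z c i.
  move=> abc i /andP[i0]; rewrite ltnS => ij.
  by rewrite (tmul_cross_terms (k := j.+1)) ?Z0 ?i0 ?leqW// (chen_level Zm abc) ?i0.
rewrite (cross_terms_eq (sub _ _ _ (splits_pt hST h1 h2 h3 (le_trans h4 h5))) (fun _ _ => erefl)).
rewrite (cross_terms_eq (fun _ _ => erefl) (sub _ _ _ (splits_pt hST (le_trans h1 h2) h3 h4 h5))).
by [].
Qed.

(** Under the hypothesis on phi, Z has finite q-variation with q = j / phi < j + 1.
    The cross terms at level j + 1 are then O(w^((j+1)/q)) with (j+1)/q > 1, and
    sewing them yields the new level, which is of the same order.  It is
    this order, above 1, that makes extensions negligible when additive functions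
    are compared. *)
Lemma Ext_spec j (Z : tmap) w phi : (0 < j)%N -> chen j Z -> is_control w ->
  j%:R / j.+1%:R < phi -> phi <= 1 -> levels_bigO j w (fun=> phi) Z ->
  [/\ chen j.+1 (Ext j Z), forall a i, (i <= j)%N -> Ext j Z a i = Z a i
    & exists2 th, 1 < th & bigO w th (fun a => Ext j Z a j.+1)].
Proof.
move=> j0 Zm cw hphi phi1 hZ.
have [Zj Z0 _] := Zm.
have jR : 0 < j%:R :> R by rewrite ltr0n.
have phi0 : 0 < phi by rewrite (le_lt_trans _ hphi)// divr_ge0.
pose q := j%:R / phi.
have q0 : 0 < q by rewrite divr_gt0.
have q1 : 1 <= q by rewrite ler_pdivlMr// mul1r (le_trans phi1)// ler1n.
have qj : q < j.+1%:R by rewrite ltr_pdivrMr// mulrC -ltr_pdivrMr.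
have hq : levels_bigO j w (fun i => i%:R / q) Z.
  apply: levels_bigO_weaken cw _ hZ => // i /andP[i0 ij].
  rewrite divr_gt0 ?ltr0n//= /q invf_div mulrA ler_pdivrMr// mulrC.
  by rewrite ler_wpM2l ?(ltW phi0)// ler_nat.
have th1 : 1 < j.+1%:R / q by rewrite ltr_pdivlMr// mul1r.
have [h hh hadd] : exists2 h : tri -> E j.+1, bigO w (j.+1%:R / q) h &
    forall a b c, splits a b c -> h c = h a + h b + cross_terms j.+1 (Z a) (Z b).
  apply: (@cocycle_sewing R S T hST (E j.+1) w _ (fun a b _ => cross_terms j.+1 (Z a) (Z b)) cw th1).
    by move=> *; exact: chen_cocycle.
  apply: (bigO_cross_terms (E := E) (e1 := fun i => i%:R / q) (e2 := fun i => i%:R / q) hST cw).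
    exact: lt_trans th1.
  move=> i /andP[i0 ij]; have ij' : (0 < j.+1 - i <= j)%N.
    by rewrite subn_gt0 ij leq_subLR -addn1 addnC leq_add2r.
  split.
  - by rewrite divr_gt0// ltr0n.
  - by apply: hq; rewrite i0.
  - by rewrite divr_gt0// ltr0n subn_gt0.
  - exact: hq.
  - by rewrite -mulrDl -natrD subnKC// ltnW.
pose Y := tmap_add Z (fun a => single (h a)).
have Ym : chen j.+1 Y := chen_extend Zm hadd.
have Ylo a i : (i <= j)%N -> Y a i = Z a i.
  by move=> ij; rewrite /Y /tmap_add single_neq ?addr0// ltn_eqF.
have Ytop a : Y a j.+1 = h a by rewrite /Y /tmap_add single_id Zj ?add0r.
have Yext : is_extension j Z Y.
  exists q; split=> //.
    by apply/(OmegaP hST _ _ q1); split=> //; exists w.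
  apply/(OmegaP hST _ _ q1); split=> //; exists w => // i /andP[i0].
  rewrite leq_eqVlt => /orP[/eqP->|]; first by apply: bigO_ext hh => a; rewrite Ytop.
  rewrite ltnS => ij; have := hq i; rewrite i0 ij => /(_ isT).
  by apply: bigO_ext => a; rewrite Ylo.
have -> : Ext j Z = Y.
  by apply: (is_extension_unique _ Yext); exact: (@xgetPex _ _ (is_extension j Z) (ex_intro _ Y Yext)).
by split=> //; exists (j.+1%:R / q) => //; apply: bigO_ext hh => a; rewrite Ytop.
Qed.

Section Fixed.
Context (p : R) (p1 : 1 <= p).

Let k := Num.truncn p.

Let p0 : 0 < p. Proof. exact: lt_le_trans p1. Qed.

Let k0 : (0 < k)%N. Proof. by rewrite truncn_gt0. Qed.

Let kp : k%:R <= p. Proof. by rewrite truncn_le ltW. Qed.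

Lemma level_exponent i : (0 < i <= k)%N -> 0 < i%:R / p <= 1.
Proof.
move=> /andP[i0 ik]; rewrite divr_gt0 ?ltr0n//= ler_pdivrMr// mul1r.
by rewrite (le_trans _ kp)// ler_nat.
Qed.

Lemma level_exponent_lt i : (i < k)%N -> i%:R / p <= 1 - 1 / p.
Proof.
move=> ik; rewrite ler_pdivrMr// mulrBl !mul1r mulVf ?gt_eqF//.
rewrite lerBrDr (le_trans _ kp)//.
by rewrite -[X in _ + X]/(1%:R) -natrD addn1 ler_nat.
Qed.

(** The exponents allowed in [calH p] are large enough to extend at every level
    below the integer part of p, because j / (j + 1) <= 1 - 1 / p there. *)
Lemma ext_exponent j phi : 1 - 1 / p < phi -> (j < k)%N -> j%:R / j.+1%:R < phi.
Proof.
move=> hphi jk; apply: le_lt_trans hphi.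
have -> : j%:R / j.+1%:R = 1 - 1 / j.+1%:R :> R.
  by apply/eqP; rewrite eq_sym subr_eq -mulrDl natr1 divff ?pnatr_eq0.
rewrite lerD2l lerN2 !div1r lef_pV2 ?posrE//.
by rewrite (le_trans _ kp)// ler_nat.
Qed.

(** The elements of [calH p] whose p-variation and whose extra regularity are both
    witnessed by w and phi, so that two elements can be given common witnesses. *)
Record calH_data (w : tri -> R) (phi : R) (H : tmap) : Prop := CalHData {
  data_control : is_control w;
  data_phi_gt : 1 - 1 / p < phi;
  data_phi_le : phi <= 1;
  data_mult : chen k H;
  data_pvar : levels_bigO k w (fun i => i%:R / p) H;
  data_phi : levels_bigO k w (fun=> phi) H }.

Lemma phi_gt0 phi : 1 - 1 / p < phi -> 0 < phi.
Proof.
by apply: le_lt_trans; rewrite subr_ge0 ler_pdivrMr// mul1r.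
Qed.

Lemma calHP (H : tmap) : calH p H <-> exists w phi, calH_data w phi H.
Proof.
split=> [[/(OmegaP hST _ _ p1)[Hm [w1 c1 h1]] [w2 [phi [K [c2 hphi phi1 K0 h2]]]]]|].
  exists (fun a => w1 a + w2 a), phi; split=> //; first exact: controlD.
    move=> i ik; apply: bigO_control_le (h1 i ik) => // [|a].
      by have /andP[/ltW] := level_exponent ik.
    by rewrite lerDl (control_ge0 c2).
  move=> i ik; apply: (@bigO_control_le _ _ _ w2) => // [|a|].
  - exact: ltW (phi_gt0 hphi).
  - by rewrite lerDr (control_ge0 c1).
  - by exists K => // a; exact: h2.
move=> [w [phi [cw hphi phi1 Hm hp hH]]]; split.
  by apply/(OmegaP hST _ _ p1); split=> //; exists w.
have [K K0 hK] := bigO_uniform hH.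
by exists w, phi, K; split=> // a j jk; exact: hK.
Qed.

Lemma calH_data_le w phi w' phi' H : calH_data w phi H -> is_control w' ->
  (forall a, w a <= w' a) -> 1 - 1 / p < phi' -> phi' <= phi -> calH_data w' phi' H.
Proof.
move=> [cw hphi phi1 Hm hp hH] cw' ww' hphi' phi'phi; split=> //.
- exact: le_trans phi1.
- move=> i ik; apply: bigO_control_le (hp i ik) => //.
  by have /andP[/ltW] := level_exponent ik.
- apply: (levels_bigO_weaken hST (e := fun=> phi)) => // [i _|i ik].
    by rewrite (phi_gt0 hphi').
  exact: bigO_control_le (ltW (phi_gt0 hphi)) ww' (hH i ik).
Qed.

Lemma calH_common X Y : calH p X -> calH p Y ->
  exists w phi, calH_data w phi X /\ calH_data w phi Y.
Proof.
move=> /calHP[w1 [f1 h1]] /calHP[w2 [f2 h2]].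
have c1 := data_control h1; have c2 := data_control h2.
exists (fun a => w1 a + w2 a), (Num.min f1 f2).
have m : 1 - 1 / p < Num.min f1 f2 by rewrite lt_min (data_phi_gt h1) (data_phi_gt h2).
split.
  apply: calH_data_le h1 (controlD c1 c2) _ m _ => [a|].
    by rewrite lerDl (control_ge0 c2).
  by rewrite ge_min lexx.
apply: calH_data_le h2 (controlD c1 c2) _ m _ => [a|].
  by rewrite lerDr (control_ge0 c1).
by rewrite ge_min lexx orbT.
Qed.

End Fixed.

End Extension.

(** * The sewing of almost multiplicative functionals *)

Section SewingRoughPaths.
Context (R : realType) (V : completeNormedModType R) (E : tensor_powers V).
Context (S T : R) (hST : S <= T) (p : R) (p1 : 1 <= p).

Local Notation tri := (triangle S T).
Local Notation tmap := (tmap E S T).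

Let k := Num.truncn p.

Let p0 : 0 < p. Proof. exact: lt_le_trans p1. Qed.

Lemma is_sewing_unique m (A Z1 Z2 : tmap) :
  is_sewing m A Z1 -> is_sewing m A Z2 -> Z1 = Z2.
Proof.
move=> [q1 [th1 [w1 [q11 t1 c1 _ [/(OmegaP hST _ _ q11)[m1 _] [C1 h1]]]]]].
move=> [q2 [th2 [w2 [q21 t2 c2 _ [/(OmegaP hST _ _ q21)[m2 _] [C2 h2]]]]]].
apply: (chen_unique hST (controlD c1 c2) _ m1 m2 (th := Num.min th1 th2)).
  by rewrite lt_min t1.
move=> i im.
have [H1 H2] := common_bigO hST (E i) c1 c2 (lt_trans ltr01 t1) (lt_trans ltr01 t2).
have b1 : bigO w1 th1 (fun a => Z1 a i - A a i).
  by apply: (@bigO_of_le _ _ _ _ _ C1) => a; exact: h1.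
have b2 : bigO w2 th2 (fun a => Z2 a i - A a i).
  by apply: (@bigO_of_le _ _ _ _ _ C2) => a; exact: h2.
apply: bigO_ext (bigOB (H1 _ b1) (H2 _ b2)) => a.
by zmod.
Qed.

Section Sew.
Context (w : tri -> R) (cw : is_control w) (th : R) (th1 : 1 < th).

Let th0 : 0 < th. Proof. exact: lt_trans th1. Qed.

(** A perturbation of order th > 1 does not change finite p-variation, because
    i / p <= 1 at all levels i up to the integer part of p. *)
Lemma near_pvar m (A Z : tmap) : (m <= k)%N ->
  levels_bigO m w (fun i => i%:R / p) A ->
  (forall i, (0 < i <= m)%N -> bigO w th (fun a => Z a i - A a i)) ->
  levels_bigO m w (fun i => i%:R / p) Z.
Proof.
move=> mk hA hZ i im; have /andP[e0 e1] : 0 < i%:R / p <= 1.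
  by apply: level_exponent => //; case/andP: im => -> /leq_trans->.
have := bigOD (bigO_weaken (control_bound hST cw) e0 (le_trans e1 (ltW th1)) (hZ i im)) (hA i im).
by apply: bigO_ext => a; rewrite subrK.
Qed.

(** By induction on the level.  If the levels up to m of Z are constructed, the
    correction of A at level m + 1 must be sewn from the cocycle
      cross_terms(Z) + A(s,u) + A(u,t) - A(s,t),
    which is the defect of A plus the difference of the cross terms of Z and of
    A; the latter is of order th since Z - A is. *)
Lemma sewing_construct m (A : tmap) : (m <= k)%N ->
  levels_bigO k w (fun i => i%:R / p) A ->
  (forall i, (0 < i <= k)%N -> bigO (w \o cutw) th (fun x : cut S T =>
     A (cutl x) i + A (cutr x) i + cross_terms i (A (cutl x)) (A (cutr x)) - A (cutw x) i)) ->
  exists2 Z : tmap, chen m Z & forall i, (0 < i <= m)%N -> bigO w th (fun a => Z a i - A a i).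
Proof.
move=> + hA defA; elim: m => [_|m IH mk].
  by exists (fun=> tone E) => [|[]//]; exact: chen_tone.
have [Z Zm hZ] := IH (ltnW mk).
have [Zk _ _] := Zm.
have hAm : levels_bigO m w (fun i => i%:R / p) A.
  by move=> i /andP[i0 im]; apply: hA; rewrite i0 (leq_trans im)// ltnW.
have hZp := near_pvar (ltnW mk) hAm hZ.
pose F a b c := cross_terms m.+1 (Z a) (Z b) + (A a m.+1 + A b m.+1 - A c m.+1).
have exp0 i : (0 < i)%N -> 0 < i%:R / p by move=> i0; rewrite divr_gt0// ltr0n.
have [h hh hadd] : exists2 h : tri -> E m.+1, bigO w th h &
    forall a b c, splits a b c -> h c = h a + h b + F a b c.
  apply: (@cocycle_sewing R S T hST (E m.+1) w _ F cw th1).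
    move=> s u v t h1 h2 h3 h4 h5; rewrite /F.
    have := chen_cocycle hST Zm h1 h2 h3 h4 h5.
    move: (cross_terms _ _ _) (cross_terms _ _ _) (cross_terms _ _ _) (cross_terms _ _ _) => a b c d H.
    rewrite [LHS]addrACA H [RHS]addrACA; congr (_ + _); zmod.
  have def1 := defA m.+1 mk.
  have inn1 : bigO (w \o cutw) th (fun x : cut S T =>
      cross_terms m.+1 (fun i => Z (cutl x) i - A (cutl x) i) (Z (cutr x))).
    apply: (@bigO_cross_terms _ _ E _ _ hST _ w (fun=> th) (fun i => i%:R / p) _
      (fun a i => Z a i - A a i) Z cw th0) => i /andP[i0 im].
    split=> //; first by apply: hZ; rewrite i0.
    - by rewrite exp0// subn_gt0.
    - by apply: hZp; rewrite subn_gt0 im leq_subLR -addn1 addnC leq_add2r.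
    - by rewrite lerDl ltW// exp0// subn_gt0.
  have inn2 : bigO (w \o cutw) th (fun x : cut S T =>
      cross_terms m.+1 (A (cutl x)) (fun i => Z (cutr x) i - A (cutr x) i)).
    apply: (@bigO_cross_terms _ _ E _ _ hST _ w (fun i => i%:R / p) (fun=> th) _
      A (fun a i => Z a i - A a i) cw th0) => i /andP[i0 im].
    split=> //; first exact: exp0.
    - by apply: hAm; rewrite i0.
    - by apply: hZ; rewrite subn_gt0 im leq_subLR -addn1 addnC leq_add2r.
    - by rewrite lerDr ltW// exp0.
  apply: bigO_ext (bigOD def1 (bigOD inn1 inn2)) => x.
  rewrite -cross_termsB /F; zmod.
pose Z' := tmap_add Z (fun a => single (A a m.+1 + h a)).
have Zlo a i : (i <= m)%N -> Z' a i = Z a i.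
  by move=> im; rewrite /Z' /tmap_add single_neq ?addr0// ltn_eqF.
have Ztop a : Z' a m.+1 = A a m.+1 + h a by rewrite /Z' /tmap_add single_id Zk ?add0r.
exists Z'.
  apply: chen_extend Zm _ => a b c abc; rewrite (hadd _ _ _ abc) /F; zmod.
move=> i /andP[i0]; rewrite leq_eqVlt => /orP[/eqP->|].
  by apply: bigO_ext hh => a; rewrite Ztop addrC addKr.
rewrite ltnS => im; have := hZ i; rewrite i0 im => /(_ isT).
by apply: bigO_ext => a; rewrite Zlo.
Qed.

Lemma sewing_spec (A : tmap) :
  (forall a, tensor_alg k (A a)) -> (forall a, A a 0%N = tone0 E) ->
  levels_bigO k w (fun i => i%:R / p) A ->
  (forall i, (0 < i <= k)%N -> bigO (w \o cutw) th (fun x : cut S T =>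
     A (cutl x) i + A (cutr x) i + cross_terms i (A (cutl x)) (A (cutr x)) - A (cutw x) i)) ->
  chen k (sewing k A) /\
  forall i, (0 < i <= k)%N -> bigO w th (fun a => sewing k A a i - A a i).
Proof.
move=> Ak A0 hA defA.
have [Z Zm hZ] := sewing_construct (leqnn k) hA defA.
suff Zsew : is_sewing k A Z.
  have -> : sewing k A = Z.
    by apply: (is_sewing_unique _ Zsew); exact: (@xgetPex _ _ (is_sewing k A) (ex_intro _ Z Zsew)).
  by split.
have [K1 K10 f1] := bigO_finite_variation p1 hA.
have [K2 K20 f2] : exists2 K, 0 <= K & forall (x : cut S T) i, (0 < i <= k)%N ->
    `|A (cutl x) i + A (cutr x) i + cross_terms i (A (cutl x)) (A (cutr x)) - A (cutw x) i|
    <= K * w (cutw x) `^ th.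
  pose D : nat -> R := fun i => xget 0 [set K | 0 <= K /\ forall x : cut S T,
    `|A (cutl x) i + A (cutr x) i + cross_terms i (A (cutl x)) (A (cutr x)) - A (cutw x) i|
    <= K * w (cutw x) `^ th].
  have hD i : (0 < i <= k)%N -> 0 <= D i /\ forall x : cut S T,
    `|A (cutl x) i + A (cutr x) i + cross_terms i (A (cutl x)) (A (cutr x)) - A (cutw x) i|
    <= D i * w (cutw x) `^ th.
    move=> /defA[K K0 hK]; rewrite /D; case: xgetP => [K' -> []//|/(_ K)]; case; split=> //.
  exists (\sum_(i < k.+1) `|D i|) => [|x i ik]; first exact: sumr_ge0.
  have [D0 hDi] := hD i ik; rewrite (le_trans (hDi x))// ler_wpM2r ?powR_ge0//.
  have ik' : (i < k.+1)%N by case/andP: ik.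
  rewrite (bigD1 (Ordinal ik'))//= (le_trans (ler_norm _))// lerDl.
  by rewrite sumr_ge0.
exists p, th, w; split=> //.
  split=> //; exists (K1 + K2); split.
  - exact: addr_ge0.
  - by apply: finite_variation_le f1 => //; rewrite lerDl.
  - move=> a b c i abc ik; rewrite (tmul_cross_terms ik) ?A0//.
    by rewrite (le_trans (f2 (Cut abc) i ik))// ler_wpM2r ?powR_ge0// lerDr.
split.
  by apply/(OmegaP hST _ _ p1); split=> //; exists w => //; exact: near_pvar hA hZ.
have [K K0 hK] : exists2 K, 0 <= K & forall i a, (0 < i <= k)%N ->
   `|(fun a i => Z a i - A a i) a i| <= K * w a `^ th.
  exact: (@bigO_uniform R V E S T w k (fun a i => Z a i - A a i) (fun=> th) hZ).
by exists K => a i ik; exact: hK.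
Qed.

End Sew.

(** The cross terms are bilinear, so the defect of X + Y consists of the mixed terms
    X^i (x) Y^j and Y^i (x) X^j.  One factor is O(w^(1/p)) and the other O(w^phi),
    with 1/p + phi > 1. *)
Lemma boxplus_spec X Y w phi : calH_data p w phi X -> calH_data p w phi Y ->
  chen k (boxplus p X Y : tmap) /\ exists2 th, 1 < th &
  forall i, (0 < i <= k)%N ->
    bigO w th (fun a => (boxplus p X Y : tmap) a i - (X a i + Y a i)).
Proof.
move=> [cw hphi phi1 Xm Xp Xphi] [_ _ _ Ym Yp Yphi].
pose th := p^-1 + phi.
have th1 : 1 < th by rewrite /th -ltrBlDl -[p^-1]div1r.
have [Xk X0 _] := Xm; have [Yk Y0 _] := Ym.
have oplusE a i : (0 < i <= k)%N -> oplus k X Y a i = X a i + Y a i.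
  by case: i => //= i ik; rewrite ik.
have phi0 := phi_gt0 p1 hphi.
have p10 : 0 < p^-1 by rewrite invr_gt0.
have low (Z : tmap) : levels_bigO k w (fun i => i%:R / p) Z -> levels_bigO k w (fun=> p^-1) Z.
  apply: levels_bigO_weaken => // i /andP[i0 _].
  by rewrite p10 -[leLHS]mul1r ler_wpM2r ?(ltW p10)// ler1n.
have [| | | |Zm hZ] := @sewing_spec w cw th th1 (oplus k X Y).
- by move=> a [|i]//= ki; rewrite ltnNge -ltnS ki.
- by [].
- move=> i ik; apply: bigO_ext (bigOD (Xp i ik) (Yp i ik)) => a.
  by rewrite oplusE.
- move=> i ik.
  have cross (Z1 Z2 : tmap) : levels_bigO k w (fun i => i%:R / p) Z1 -> levels_bigO k w (fun=> phi) Z2 ->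
     bigO (w \o cutw) th (fun x : cut S T => cross_terms i (Z1 (cutl x)) (Z2 (cutr x))) /\
     bigO (w \o cutw) th (fun x : cut S T => cross_terms i (Z2 (cutl x)) (Z1 (cutr x))).
    move=> /low h1 h2; have lvl j : (0 < j < i)%N -> ((0 < j <= k) && (0 < i - j <= k))%N.
      move=> /andP[j0 ji]; case/andP: ik => i0 ik; rewrite j0 (leq_trans (ltnW ji))//= subn_gt0 ji.
      exact: leq_trans (leq_subr _ _) ik.
    split.
      apply: (@bigO_cross_terms _ _ E _ _ hST _ w (fun=> p^-1) (fun=> phi) _ Z1 Z2 cw) => [|j /lvl/andP[j1 j2]].
        exact: lt_trans th1.
      by split=> //; [exact: h1|exact: h2].
    apply: (@bigO_cross_terms _ _ E _ _ hST _ w (fun=> phi) (fun=> p^-1) _ Z2 Z1 cw) => [|j /lvl/andP[j1 j2]].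
      exact: lt_trans th1.
    by split=> //; [exact: h2|exact: h1|rewrite /th addrC].
  have [b1 _] := cross _ _ Xp Yphi; have [_ b2] := cross _ _ Xp Yphi.
  apply: bigO_ext (bigOD b1 b2) => x; have abc := cutP x.
  have ope j : (0 < j < i)%N -> forall a, oplus k X Y a j = X a j + Y a j.
    move=> /andP[j0 ji] a; apply: oplusE; rewrite j0 (leq_trans (ltnW ji))//.
    by case/andP: ik.
  rewrite !oplusE// (cross_terms_eq (fun j ji => ope j ji _) (fun j ji => ope j ji _)) cross_termsD.
  rewrite (chen_level Xm abc ik) (chen_level Ym abc ik); zmod.
split; first exact: Zm.
exists th => // i ik; apply: bigO_ext (hZ i ik) => a.
by rewrite oplusE.
Qed.

Lemma boxplus_data X Y w phi : calH_data p w phi X -> calH_data p w phi Y ->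
  calH_data p w phi (boxplus p X Y : tmap).
Proof.
move=> dX dY; have [Zm [th th1 hZ]] := boxplus_spec dX dY.
have [cw hphi phi1 Xm Xp Xphi] := dX; have [_ _ _ Ym Yp Yphi] := dY.
split=> //.
  apply: (near_pvar cw th1 (A := fun a i => X a i + Y a i)) => //.
  by move=> i ik; exact: (bigOD (Xp i ik) (Yp i ik)).
move=> i ik; have phi0 := phi_gt0 p1 hphi.
have h := bigO_weaken (control_bound hST cw) phi0 (le_trans phi1 (ltW th1)) (hZ i ik).
by apply: bigO_ext (bigOD h (bigOD (Xphi i ik) (Yphi i ik))) => a; rewrite subrK.
Qed.

End SewingRoughPaths.

(** * Development, lift and the vector space *)

Section Development.
Context (R : realType) (V : completeNormedModType R) (E : tensor_powers V).
Context (S T : R) (hST : S <= T) (p : R) (p1 : 1 <= p).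

Local Notation tri := (triangle S T).
Local Notation tmap := (tmap E S T).

Let k := Num.truncn p.

Let p0 : 0 < p. Proof. exact: lt_le_trans p1. Qed.

Let k0 : (0 < k)%N. Proof. by rewrite truncn_gt0. Qed.

Lemma cross_terms1 (a b : tseq E) : cross_terms 1 a b = 0.
Proof. by rewrite /cross_terms big_pred0// => i; case: (nat_of_ord i) => [|[]]. Qed.

Lemma dev1 (H : tmap) a : dev k H a 1%N = H a 1%N.
Proof. by []. Qed.

Lemma devS (H : tmap) a j : (0 < j < k)%N ->
  dev k H a j.+1 = H a j.+1 - Ext j (truncate j H) a j.+1.
Proof. by case: j => // j /=; rewrite /dev => ->. Qed.

Lemma dev_out (H : tmap) a i : ~~ (0 < i <= k)%N -> dev k H a i = 0.
Proof.
case: i => [//|[|i]] /=; first by rewrite k0.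
by rewrite /dev /= => /negbTE->.
Qed.

Lemma Ext_truncate w phi (H : tmap) j : calH_data p w phi H -> (0 < j < k)%N ->
  [/\ chen j.+1 (Ext j (truncate j H)),
      forall a i, (i <= j)%N -> Ext j (truncate j H) a i = H a i
    & exists2 th, 1 < th & bigO w th (fun a => Ext j (truncate j H) a j.+1)].
Proof.
move=> [cw hphi phi1 Hm _ Hphi] /andP[j0 jk].
have tH : levels_bigO j w (fun=> phi) (truncate j H).
  move=> i /andP[i0 ij]; have := Hphi i; rewrite i0 (leq_trans ij (ltnW jk)) => /(_ isT).
  by apply: bigO_ext => a; rewrite /truncate ij.
have [m1 m2 m3] := Ext_spec hST j0 (chen_truncate (ltnW jk) Hm) cw
  (ext_exponent p1 hphi jk) phi1 tH.
by split=> // a i ij; rewrite m2// /truncate ij.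
Qed.

Lemma additive_top_sub j (X Y : tmap) a b c : chen j.+1 Y -> 
  (forall a b c, splits a b c -> X c j.+1 = X a j.+1 + X b j.+1 + cross_terms j.+1 (X a) (X b)) ->
  (forall a i, (i <= j)%N -> Y a i = X a i) -> splits a b c ->
  (X a j.+1 - Y a j.+1) + (X b j.+1 - Y b j.+1) = X c j.+1 - Y c j.+1.
Proof.
move=> Ym Xadd XY abc; rewrite (Xadd _ _ _ abc) (chen_level Ym abc) ?leqnn//.
rewrite (@cross_terms_eq _ _ _ _ (Y a) (Y b) (X a) (X b)); first zmod.
- by move=> i /andP[_]; rewrite ltnS; exact: XY.
- by move=> i /andP[_]; rewrite ltnS; exact: XY.
Qed.

(** The additive functionals that [dev] produces and that can be lifted, with
    witnesses w and phi.  The order k / p is a separate condition at the top level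
    k, because phi may be smaller than k / p; it exceeds i / p below k. *)
Record additive_data (w : tri -> R) (phi : R) (I : tmap) : Prop := AdditiveData {
  add_control : is_control w;
  add_phi_gt : 1 - 1 / p < phi;
  add_phi_le : phi <= 1;
  add_additive : forall i, (0 < i <= k)%N -> forall a b c, splits a b c -> I a i + I b i = I c i;
  add_phi : levels_bigO k w (fun=> phi) I;
  add_top : bigO w (k%:R / p) (fun a => I a k) }.

(** H and the extension of its lower levels have the same cross terms, so their
    difference is additive. *)
Lemma dev_data w phi (H : tmap) : calH_data p w phi H -> additive_data w phi (dev k H).
Proof.
move=> dH; have [cw hphi phi1 Hm Hp Hphi] := dH.
split=> //.
- case=> [//|[|j]] jk a b c abc.
    rewrite !dev1 (chen_level Hm abc jk).
    by rewrite cross_terms1 addr0.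
  rewrite !devS//; have [m1 m2 _] := Ext_truncate dH (jk : (0 < j.+1 < k)%N).
  apply: (additive_top_sub m1 _ m2 abc) => a' b' c' abc'.
  exact: (chen_level Hm abc' jk).
- case=> [//|[|j]] jk; first exact: (Hphi 1%N jk).
  have [_ _ [th th1 hth]] := Ext_truncate dH (jk : (0 < j.+1 < k)%N).
  have hth' := bigO_weaken (control_bound hST cw) (phi_gt0 p1 hphi) (le_trans phi1 (ltW th1)) hth.
  by apply: bigO_ext (bigOB (Hphi _ jk) hth') => a; rewrite devS.
- suff pvar i : (0 < i <= k)%N -> bigO w (i%:R / p) (fun a => dev k H a i).
    by apply: pvar; rewrite k0 leqnn.
  case: i => [//|[|j]] jk; first exact: (Hp 1%N jk).
  have /andP[e0 e1] := level_exponent p1 jk.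
  have [_ _ [th th1 hth]] := Ext_truncate dH (jk : (0 < j.+1 < k)%N).
  have hth' := bigO_weaken (control_bound hST cw) e0 (le_trans e1 (ltW th1)) hth.
  by apply: bigO_ext (bigOB (Hp _ jk) hth') => a; rewrite devS.
Qed.

Lemma additive_data_scale w phi c I : additive_data w phi I ->
  additive_data w phi (tmap_scale c I).
Proof.
move=> [cw hphi phi1 Iadd Iphi Itop]; split=> //.
- by move=> i ik a b d abd; rewrite /tmap_scale -scalerDr (Iadd i ik _ _ _ abd).
- by move=> i ik; exact: (bigOZ c (Iphi i ik)).
- exact: (bigOZ c Itop).
Qed.

Lemma lift_S (I : tmap) m : (0 < m)%N ->
  lift_upto I m.+1 = tmap_add (Ext m (lift_upto I m)) (only_level m.+1 I).
Proof. by case: m. Qed.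

Section Lift.
Context (w : tri -> R) (phi : R) (I : tmap) (dI : additive_data w phi I).

Lemma lift_spec m : (0 < m <= k)%N ->
  chen m (lift_upto I m) /\ levels_bigO m w (fun=> phi) (lift_upto I m).
Proof.
have [cw hphi phi1 Iadd Iphi _] := dI.
have phi0 := phi_gt0 p1 hphi.
elim: m => [//|m IH /andP[_ mk]].
have [m0|m0] := posnP m.
  subst m; split.
    apply: chen_of_levels => [a [|[|i]] //= _|a|a b c [|[|i]] // abc _].
    - by rewrite /tmap_add /only_level /= addr0.
    - by rewrite /= /tmap_add /only_level /= addr0.
    - rewrite /= /tmap_add /only_level /= !add0r -(Iadd 1%N mk _ _ _ abc).
      by rewrite cross_terms1 addr0.
  move=> [|[|i]] // _; apply: bigO_ext (Iphi 1%N mk) => a.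
  by rewrite /= /tmap_add /only_level /= add0r.
have [|Lm Lphi] := IH; first by rewrite m0 ltnW.
have [m1 m2 [th th1 hth]] := Ext_spec hST m0 Lm cw (ext_exponent p1 hphi mk) phi1 Lphi.
rewrite lift_S//; split.
  by apply: chen_add_top m1 _; exact: Iadd.
move=> i /andP[i0]; rewrite leq_eqVlt => /orP[/eqP->|].
  have hth' := bigO_weaken (control_bound hST cw) phi0 (le_trans phi1 (ltW th1)) hth.
  apply: bigO_ext (bigOD hth' (Iphi m.+1 mk)) => a.
  by rewrite /tmap_add /only_level eqxx.
rewrite ltnS => im; have := Lphi i; rewrite i0 im => /(_ isT).
by apply: bigO_ext => a; rewrite /tmap_add /only_level ltn_eqF// addr0 m2.
Qed.

Lemma lift_Ext m : (0 < m < k)%N ->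
  [/\ forall a i, (i <= m)%N -> lift_upto I m.+1 a i = lift_upto I m a i,
      forall a, lift_upto I m.+1 a m.+1 = Ext m (lift_upto I m) a m.+1 + I a m.+1
    & exists2 th, 1 < th & bigO w th (fun a => Ext m (lift_upto I m) a m.+1)].
Proof.
move=> /andP[m0 mk]; have [cw hphi phi1 Iadd Iphi _] := dI.
have [|Lm Lphi] := @lift_spec m; first by rewrite m0 ltnW.
have [m1 m2 hth] := Ext_spec hST m0 Lm cw (ext_exponent p1 hphi mk) phi1 Lphi.
split=> // a => [i im|]; rewrite lift_S// /tmap_add /only_level ?eqxx//.
by rewrite ltn_eqF// addr0 m2.
Qed.

Lemma lift_lower m n a i : (0 < m)%N -> (m <= n <= k)%N -> (i <= m)%N ->
  lift_upto I n a i = lift_upto I m a i.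
Proof.
move=> m0 /andP[mn nk] im; elim: n mn nk => [|n IH]; first by rewrite leqn0 => /eqP->.
rewrite leq_eqVlt => /orP[/eqP->//|]; rewrite ltnS => mn nk.
have [|h _ _] := @lift_Ext n; first by rewrite nk (leq_trans m0).
by rewrite h ?(leq_trans im)// IH// ltnW.
Qed.

Lemma truncate_lift m : (0 < m <= k)%N -> truncate m (lift_upto I k) = lift_upto I m.
Proof.
move=> /andP[m0 mk]; apply/funext => a; apply: tseqP => i; rewrite /truncate.
case: leqP => im; first by rewrite (@lift_lower m)// mk leqnn.
by have [|[Lk _ _] _] := @lift_spec m; [rewrite m0|rewrite Lk].
Qed.

(** Truncating the lift at level m gives the lift of the first m levels, so the
    extension that [dev] subtracts is the one that the lift added. *)
Lemma dev_lift a i : (0 < i <= k)%N -> dev k (lift_upto I k) a i = I a i.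
Proof.
case: i => [//|[|i]] ik.
  rewrite dev1 (@lift_lower 1 k)//; last by rewrite k0 leqnn.
  by rewrite /= /tmap_add /only_level /= add0r.
rewrite devS// truncate_lift; last by rewrite /= ltnW.
rewrite (@lift_lower i.+2 k)//; last by rewrite leqnn andbT.
by have [|_ -> _] := @lift_Ext i.+1; [|rewrite addrC addKr].
Qed.

(** Below the integer part of p, phi > 1 - 1/p >= i/p; at the top level the bound
    i/p comes from the top level of I and from the order of the extension, which
    exceeds 1. *)
Lemma lift_data : calH_data p w phi (lift_upto I k).
Proof.
have [cw hphi phi1 Iadd Iphi Itop] := dI.
have kk : (0 < k <= k)%N by rewrite k0 leqnn.
have [Lm Lphi] := lift_spec kk.
split=> // i /andP[i0]; rewrite leq_eqVlt => /orP[/eqP->|ik].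
  have /andP[e0 e1] := level_exponent p1 kk.
  rewrite -/k in e0 e1 *.
  have [k1|k1] := eqVneq k 1%N.
    apply: bigO_ext Itop => a; rewrite k1 /= /tmap_add /only_level /=.
    by rewrite add0r.
  have [m Em] : exists m, k = m.+2 by case: (k) k0 k1 => [|[|m]]// _ _; exists m.
  have mk : (0 < m.+1 < k)%N by rewrite Em ltnSn.
  have [_ top [th th1 hth]] := lift_Ext mk.
  have hth' := bigO_weaken (control_bound hST cw) e0 (le_trans e1 (ltW th1)) hth.
  move: Itop hth' ; rewrite Em => Itop hth'.
  by apply: bigO_ext (bigOD hth' Itop) => a; rewrite top.
apply: bigO_weaken (control_bound hST cw) _ _ (Lphi i _).
- by rewrite divr_gt0// ltr0n.
- by rewrite (le_trans (level_exponent_lt p1 ik))// ltW.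
- by rewrite i0 ltnW.
Qed.

End Lift.

Lemma dev_inj (X Y : tmap) : chen k X -> chen k Y ->
  (forall a i, dev k X a i = dev k Y a i) -> X = Y.
Proof.
move=> [Xk X0 _] [Yk Y0 _] h.
suff H i : forall a, X a i = Y a i by apply/funext => a; apply: tseqP.
have [n] := ubnP i; elim: n i => // n IH i /ltnSE i_n a.
case: i i_n => [|[|i]] i_n; first by rewrite X0 Y0.
  by rewrite -dev1 h.
have [ik|ki] := leqP i.+2 k; last by rewrite Xk// Yk.
have := h a i.+2; rewrite !devS//.
have -> : truncate i.+1 X = truncate i.+1 Y.
  apply/funext => b; apply: tseqP => j; rewrite /truncate; case: leqP => // ji.
  by apply: IH; rewrite (leq_ltn_trans ji).
exact: addIr.
Qed.

Lemma odot_data w phi c (H : tmap) : calH_data p w phi H -> calH_data p w phi (odot p c H : tmap).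
Proof. by move=> /dev_data/(additive_data_scale c)/lift_data. Qed.

Lemma dev_odot w phi c (H : tmap) a i : calH_data p w phi H ->
  dev k (odot p c H : tmap) a i = c *: dev k H a i.
Proof.
move=> /dev_data/(additive_data_scale c) dI.
have [ik|ik] := boolP (0 < i <= k)%N; last by rewrite !dev_out// scaler0.
by rewrite /odot (dev_lift dI).
Qed.

(** The two sides are additive; their difference is of order above 1 because it is
    made of the sewing correction and of three extensions. *)
Lemma dev_boxplus w phi (X Y : tmap) a i : calH_data p w phi X -> calH_data p w phi Y ->
  dev k (boxplus p X Y : tmap) a i = dev k X a i + dev k Y a i.
Proof.
move=> dX dY; have dZ := boxplus_data hST p1 dX dY.
have [ik|ik] := boolP (0 < i <= k)%N; last by rewrite !dev_out// addr0.
have [_ [th th1 hZ]] := boxplus_spec hST p1 dX dY.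
set Z : tmap := boxplus p X Y in dZ hZ *.
apply/eqP; rewrite -subr_eq0; apply/eqP.
have cw := data_control dX.
have Dadd : forall a b c, splits a b c ->
   (dev k Z a i - (dev k X a i + dev k Y a i)) + (dev k Z b i - (dev k X b i + dev k Y b i))
   = dev k Z c i - (dev k X c i + dev k Y c i).
  move=> a' b c abc.
  rewrite -(add_additive (dev_data dZ) ik abc) -(add_additive (dev_data dX) ik abc).
  by rewrite -(add_additive (dev_data dY) ik abc); zmod.
suff [th' th'1 hD] : exists2 th', 1 < th' & bigO w th' (fun a => dev k Z a i - (dev k X a i + dev k Y a i)).
  exact: (additive_bigO_eq0 hST cw th'1 Dadd hD).
case: i ik Dadd => [//|[|i]] ik _; first by exists th => //; exact: (hZ 1%N ik).
have jk : (0 < i.+1 < k)%N := ik.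
have [_ _ [t1 t11 h1]] := Ext_truncate dZ jk.
have [_ _ [t2 t21 h2]] := Ext_truncate dX jk.
have [_ _ [t3 t31 h3]] := Ext_truncate dY jk.
pose m := Num.min (Num.min th t1) (Num.min t2 t3).
have m1 : 1 < m by rewrite /m !lt_min th1 t11 t21.
exists m => //.
have wk (W : normedModType R) t (f : tri -> W) : m <= t -> bigO w t f -> bigO w m f.
  by move=> mt; exact: (bigO_weaken (control_bound hST cw) (lt_trans ltr01 m1) mt).
have {}h1 := wk _ _ _ (_ : m <= t1) h1.
have {}h2 := wk _ _ _ (_ : m <= t2) h2.
have {}h3 := wk _ _ _ (_ : m <= t3) h3.
have hm := wk _ _ _ (_ : m <= th) (hZ i.+2 ik).
have [mm1 mm2 mm3 mm4] : [/\ m <= th, m <= t1, m <= t2 & m <= t3].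
  by rewrite /m !ge_min !lexx !orbT; split.
have hf := bigOD (bigOB (hm mm1) (h1 mm2)) (bigOD (h2 mm3) (h3 mm4)).
apply: bigO_ext hf => b; rewrite !devS//; zmod.
Qed.

Lemma tone_data : calH_data p (fun=> 0) 1 (fun _ : tri => tone E).
Proof.
have lvl0 e : levels_bigO k (fun=> 0) e (fun _ : tri => tone E).
  by case=> // i _; exact: bigO0.
split=> //; first exact: control0.
- by rewrite ltrBlDr ltrDl div1r invr_gt0.
- apply: chen_of_levels => [a [|i]//|a //|a b c [|i]// _ _].
  rewrite /= addr0 add0r /cross_terms big1// => -[[|j] jlt] //= _.
  exact: tens_at0l.
Qed.

End Development.

Theorem theorem6p8 (R : realType) (V : completeNormedModType R)
    (E : tensor_powers V) (S T : R) (hST : S <= T) (p : R) (hp : 1 <= p) :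
  is_vector_space (calH p : set (tmap E S T)) (boxplus p) (odot p).
Proof.
apply: (@vector_space_of_separating_maps R _ _ _ _ (fun _ : triangle S T => tone E)
  (triangle S T * nat)%type (fun c => E c.2)
  (fun c (X : tmap E S T) => dev (Num.truncn p) X c.1 c.2)).
- by apply/(calHP hST hp); exists (fun=> 0), 1; exact: tone_data.
- move=> X Y HX HY; have [w [phi [dX dY]]] := calH_common hST hp HX HY.
  by apply/(calHP hST hp); exists w, phi; exact: boxplus_data.
- move=> a X /(calHP hST hp)[w [phi dX]].
  by apply/(calHP hST hp); exists w, phi; exact: odot_data.
- move=> X Y /(calHP hST hp)[w [phi dX]] /(calHP hST hp)[w' [phi' dY]] devXY.
  exact: dev_inj (data_mult dX) (data_mult dY) (fun a i => devXY (a, i)).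
- move=> c X Y HX HY; have [w [phi [dX dY]]] := calH_common hST hp HX HY.
  exact: dev_boxplus dX dY.
- move=> c a X /(calHP hST hp)[w [phi dX]]; exact: dev_odot dX.
Qed.
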